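(* Let $X$ be a smooth complex analytic threefold with trivial canonical bundle and let $C\subset X$, $C\simeq\mathbf{P}^1$, be a Laufer curve with normal bundle $N\simeq\mathcal{O}(m)\oplus\mathcal{O}(-n)$, $m\ge 0$, $n\ge 2$ (so $n=m+2$), with gluing data $z_1=x^ny_1+f(x,y_2)$, $z_2=x^{-m}y_2$, $w=x^{-1}$. Let $a_0,\ldots,a_m$ be the coordinates on $H^0(C,N)$, write $$f\Big(x,\sum_{i=0}^m a_ix^i\Big)=\sum_{i=0}^\infty f_i(a_0,\ldots,a_m)\,x^i,$$ and set $k_i=-f_i$. Describe the versal deformation space $\mathcal{K}$ of $C$ in $X$ as the analytic subspace $$\mathcal{K}=\{k_1(a_0,\ldots,a_m)=\cdots=k_{n-1}(a_0,\ldots,a_m)=0\}\subset U$$ of a sufficiently small neighborhood $U$ of $0$ in $H^0(C,N)$. Then there exists a single holomorphic function $W$ on $U$ such that $\mathcal{K}$ is, as an analytic space, the subvariety of critical points of $W$; that is, the ideal sheaf on $U$ generated by $k_1,\ldots,k_{n-1}$ equals the ideal sheaf generated by $\partial W/\partial a_0,\ldots,\partial W/\partial a_m$.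
   Context: Setting. $C\simeq\mathbf{P}^1$ is a smooth rational curve in a smooth complex analytic threefold $X$ with normal bundle $N\simeq\mathcal{O}(m)\oplus\mathcal{O}(-n)$, $m\ge0$, $n\ge2$. It is assumed that $X=U_0\cup U_1$ (considerations are local near $C$), where $U_0$ is a coordinate chart of $X$ with coordinates $(x,y_1,y_2)$ in which $C$ is $y_1=y_2=0$, and $U_1$ is a coordinate chart with coordinates $(w,z_1,z_2)$ in which $C$ is $z_1=z_2=0$; $x$ and $w$ restrict to the two standard affine coordinates on $C\simeq\mathbf{P}^1$, with $w=x^{-1}$ on $C$. Let $I$ be the ideal sheaf of $C$ in $X$. In general the gluing between the charts has the form $z_1=x^ny_1+f(x,y_1,y_2)$, $z_2=x^{-m}y_2+g(x,y_1,y_2)$, $w=x^{-1}+h(x,y_1,y_2)$, with $f,g,h$ sections of $I^2$ holomorphic on $U_0\cap U_1$. Laufer curve. $C$ is called a Laufer curve if $f=f(x,y_2)$ is independent of $y_1$ and is holomorphic on all of $U_0$, and $g=h=0$. (Since $f\in I^2$, $f$ vanishes to order at least $2$ in $y_2$ along $y_2=0$.) Canonical bundle. In this setting, triviality of the canonical bundle of $X$ is equivalent to $m-n=-2$. Coordinates on $H^0(C,N)$. $H^0(C,N)=H^0(\mathbf{P}^1,\mathcal{O}(m))$ is identified with $\mathbf{C}^{m+1}$ by letting $(a_0,\ldots,a_m)$ correspond to the section given by $(0,\sum_{i=0}^m a_ix^i)$ in the trivialization of $N$ over $U_0\cap C$ and by $(0,\sum_{i=0}^m a_iw^{m-i})$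 in the trivialization over $U_1\cap C$. Versal deformation space. For a Laufer curve, the versal deformation space $\mathcal{K}$ of $C$ in $X$ (parametrizing local deformations of $C$ in $X$) is the analytic space defined, in a sufficiently small neighborhood $U$ of $0$ in $H^0(C,N)$, by the equations $k_1=\cdots=k_{n-1}=0$, where $k_i=-f_i$ and the $f_i$ are the Taylor coefficients in $x$ of $f(x,\sum_{i=0}^m a_ix^i)$; the $f_i$ are holomorphic functions of $(a_0,\ldots,a_m)$ near $0$. This description is to be taken as given. *)

(* Defs.v *)
From HB Require Import structures.
From mathcomp Require Import all_boot all_order all_algebra complex.
From mathcomp Require Import all_classical all_reals all_analysis.

Set Implicit Arguments.
Unset Strict Implicit.
Unset Printing Implicit Defensive.

Import Order.TTheory GRing.Theory Num.Theory numFieldNormedType.Exports.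

Local Open Scope classical_set_scope.
Local Open Scope ring_scope.

(* R[i] packed so that the topology and normed-module structure that
   MathComp-Analysis puts on every numClosedFieldType are found on it. *)
Definition cplx (R : realType) : numClosedFieldType := R[i]%C.

(* 'differentiable' over the scalar field cplx R is Frechet differentiability
   with a C-linear differential; continuity of the partial derivatives is the
   usual "continuously complex differentiable" definition in several complex
   variables. *)
Definition holomorphic (R : realType) (d : nat) (V : normedModType (cplx R))
    (A : set 'rV[cplx R]_d) (F : 'rV[cplx R]_d -> V) : Prop :=
  open A /\
  forall p, A p -> differentiable F p /\
    forall i : 'I_d, {for p, continuous ('D_(delta_mx 0 i) F)}.

(* [coord] and [param] are total functions, meaningful only on [dom] and on
   [image_of] below. *)
Record chart (R : realType) (d : nat) (X : topologicalType) := Chart {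
  dom : set X;
  coord : X -> 'rV[cplx R]_d;
  param : 'rV[cplx R]_d -> X;
  dom_open : open dom;
  image_open : open (coord @` dom);
  coordK : forall p, dom p -> param (coord p) = p;
  coord_continuous : forall p, dom p -> {for p, continuous coord};
  param_continuous : forall q, (coord @` dom) q -> {for q, continuous param}
}.

Definition image_of (R : realType) (d : nat) (X : topologicalType)
    (c : chart R d X) : set 'rV[cplx R]_d := coord c @` dom c.

Definition overlap (R : realType) (d : nat) (X : topologicalType)
    (c c' : chart R d X) : set 'rV[cplx R]_d :=
  coord c @` (dom c `&` dom c').

Definition transition (R : realType) (d : nat) (X : topologicalType)
    (c c' : chart R d X) : 'rV[cplx R]_d -> 'rV[cplx R]_d :=
  fun q => coord c' (param c q).

Record complex_manifold (R : realType) (d : nat) := ComplexManifold {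
  carrier :> topologicalType;
  atlas : set (chart R d carrier);
  carrier_hausdorff : hausdorff_space carrier;
  atlas_cover : forall p : carrier, exists2 c, atlas c & dom c p;
  atlas_compatible : forall c c', atlas c -> atlas c' ->
    holomorphic (overlap c c') (transition c c')
}.

(* Existence of a nowhere vanishing holomorphic d-form: omega c is its
   coefficient with respect to dx_1 /\ ... /\ dx_d in the chart c. *)
Definition trivial_canonical_bundle (R : realType) (d : nat)
    (X : complex_manifold R d) : Prop :=
  exists omega : chart R d X -> 'rV[cplx R]_d -> cplx R,
    (forall c, atlas c -> holomorphic (image_of c) (omega c) /\
       forall q, image_of c q -> omega c q != 0) /\
    (forall c c', atlas c -> atlas c' -> forall q, overlap c c' q ->
       omega c q =
       omega c' (transition c c' q) * \det (jacobian (transition c c') q)).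

(* s is a section over V of the ideal sheaf on U generated by the functions
   g_i. *)
Definition ideal_sheaf (R : realType) (d : nat) (U : set 'rV[cplx R]_d)
    (I : finType) (g : I -> 'rV[cplx R]_d -> cplx R)
    (V : set 'rV[cplx R]_d) (s : 'rV[cplx R]_d -> cplx R) : Prop :=
  V `<=` U /\ holomorphic V s /\
  forall p, V p -> exists B : set 'rV[cplx R]_d,
    open_nbhs p B /\ B `<=` V /\
    exists u : I -> 'rV[cplx R]_d -> cplx R,
      (forall i, holomorphic B (u i)) /\
      forall q, B q -> s q = \sum_i u i q * g i q.

(* s is a section over V of the ideal sheaf of D. *)
Definition vanishing_ideal (R : realType) (d : nat) (D V : set 'rV[cplx R]_d)
    (s : 'rV[cplx R]_d -> cplx R) : Prop :=
  holomorphic V s /\ forall q, V q -> D q -> s q = 0.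

(* s is a section over V of the square of the ideal sheaf of D. *)
Definition vanishing_ideal_sq (R : realType) (d : nat)
    (D V : set 'rV[cplx R]_d) (s : 'rV[cplx R]_d -> cplx R) : Prop :=
  holomorphic V s /\
  forall p, V p -> exists B : set 'rV[cplx R]_d,
    open_nbhs p B /\ B `<=` V /\
    exists (N : nat) (u v : 'I_N -> 'rV[cplx R]_d -> cplx R),
      (forall i, vanishing_ideal D B (u i) /\ vanishing_ideal D B (v i)) /\
      forall q, B q -> s q = \sum_i u i q * v i q.

Definition pt3 (R : realType) (x y1 y2 : cplx R) : 'rV[cplx R]_3 :=
  \row_(i < 3) [:: x; y1; y2]`_i.

Definition axis (R : realType) : set 'rV[cplx R]_3 :=
  range (fun x : cplx R => pt3 x 0 0).
Arguments axis R : clear implicits.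

(* c0 has coordinates (x, y1, y2) and c1 has coordinates (w, z1, z2).  The
   isomorphism of C with P^1 and the splitting O(m) + O(-n) of its normal
   bundle are encoded by the gluing. *)
Record laufer_curve (R : realType) (X : complex_manifold R 3) (C : set X)
    (m n : nat) (c0 c1 : chart R 3 X) (f : cplx R -> cplx R -> cplx R) :
    Prop := LauferCurve {
  laufer_atlas0 : atlas c0;
  laufer_atlas1 : atlas c1;
  laufer_cover : dom c0 `|` dom c1 = setT;
  laufer_curve0 : forall p, dom c0 p -> (C p <-> axis R (coord c0 p));
  laufer_curve1 : forall p, dom c1 p -> (C p <-> axis R (coord c1 p));
  (* x and w restrict to the standard affine coordinates of P^1 *)
  laufer_affine0 : axis R `<=` image_of c0;
  laufer_affine1 : axis R `<=` image_of c1;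
  laufer_overlap0 : forall t : cplx R, t != 0 -> overlap c0 c1 (pt3 t 0 0);
  laufer_overlap1 : forall t : cplx R, t != 0 -> overlap c1 c0 (pt3 t 0 0);
  (* x is required not to vanish because 0^-1 = 0 *)
  laufer_gluing : forall p x y1 y2, dom c0 p -> dom c1 p ->
    coord c0 p = pt3 x y1 y2 ->
    x != 0 /\
    coord c1 p = pt3 (x^-1) (x ^+ n * y1 + f x y2) (x ^- m * y2);
  (* f is holomorphic on all of U_0 and belongs to I^2 *)
  laufer_f : vanishing_ideal_sq (axis R) (image_of c0)
    (fun q => f (q 0 0) (q 0 (inord 2)))
}.

(* Local expression over U_0 of the section of N with coordinates
   (a_0, ..., a_m). *)
Definition normal_section (R : realType) (m : nat) (a : 'rV[cplx R]_m.+1)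
    (x : cplx R) : cplx R := \sum_(i < m.+1) a 0 i * x ^+ i.

(* f(x, a_0 + ... + a_m x^m) = f_0(a) + f_1(a) x + f_2(a) x^2 + ... near
   x = 0, for a near 0; this determines each f_i in a neighborhood of 0. *)
Definition taylor_expansion (R : realType) (m : nat)
    (f : cplx R -> cplx R -> cplx R)
    (f_ : nat -> 'rV[cplx R]_m.+1 -> cplx R) : Prop :=
  \forall a \near (0 : 'rV[cplx R]_m.+1), \forall x \near (0 : cplx R),
    series (fun i => f_ i a * x ^+ i) @ \oo --> f x (normal_section a x).

(* k_(i+1) = - f_(i+1) for 0 <= i < n - 1, so that the k_i are listed from
   k_1 to k_(n-1). *)
Definition versal_equations (R : realType) (m n : nat)
    (f_ : nat -> 'rV[cplx R]_m.+1 -> cplx R) (i : 'I_n.-1)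
    (a : 'rV[cplx R]_m.+1) : cplx R := - f_ i.+1 a.

Definition partials (R : realType) (d : nat) (W : 'rV[cplx R]_d -> cplx R)
    (j : 'I_d) : 'rV[cplx R]_d -> cplx R := 'D_(delta_mx 0 j) W.

(* Main.v *)
Require Import Defs.
From HB Require Import structures.
From mathcomp Require Import all_boot all_order all_algebra complex.
From mathcomp Require Import all_classical all_reals all_analysis.
From mathcomp Require Import ring lra.

Set Implicit Arguments.
Unset Strict Implicit.
Unset Printing Implicit Defensive.

Import Order.TTheory GRing.Theory Num.Theory numFieldNormedType.Exports.

Local Open Scope classical_set_scope.
Local Open Scope ring_scope.

(* Write s_a(x) = a_0 + ... + a_m x^m and let Phi(x, y) be the primitive in y of
   -f(x, y) that vanishes at y = 0.  The potential W(a) is the coefficient of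
   x^(m+1) in Phi(x, s_a(x)): differentiating, dW/da_j is the coefficient of
   x^(m+1) in -x^j f(x, s_a(x)), that is -f_(m+1-j) = k_(m+1-j), so the partial
   derivatives of W are k_1, ..., k_(m+1) in reverse order.  Taylor coefficients
   are written as Cauchy integrals over a fixed circle, which makes them
   holomorphic functions of a.

   It remains to see that n = m + 2.  Along C the coefficients g0, g1 of a nowhere
   vanishing 3-form in the two charts are entire functions without zeros such that
   g0(t) = - t^(n-m-2) g1(1/t).  If n < m + 2 then g0 tends to 0 at infinity, and if
   n > m + 2 then 1/g0 does, which contradicts the mean value property. *)

(** * Real and imaginary parts, continuity *)

(** Complex analysis is reduced to real integrals over [0, 1]. Differentiability is carried by a
    difference quotient that is continuous at the base point, and Hadamard's formula writes this
    quotient as an integral of the derivative; differentiating under an integral sign then amounts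
    to the continuity of a parametric integral over a compact interval. The continuity of
    derivatives that is part of [holomorphic] makes the real fundamental theorem of calculus
    applicable, and Cauchy's theorem for circles follows by differentiating a mean with respect to
    the radius.

    The obstacle is [taylor_expansion]: for each a it gives only pointwise convergence, for x in a
    neighbourhood of 0 that may shrink with a, and nothing on how the f_i depend on a. Each f_i(a)
    must therefore be identified with an integral over a circle whose radius does not depend on a.
    For a single a, the mean of the remainder quotient is carried from that circle to circles
    shrinking to 0, where the expansion is available. *)

Section ComplexReal.
Context {R : realType}.
Local Notation C := (cplx R).

Definition re (z : C) : R := complex.Re z.
Definition im (z : C) : R := complex.Im z.
Definition rc (x : R) : C := x%:C%C.
Definition mkc (x y : R) : C := (x +i* y)%C.

Lemma rc_is_zmod : zmod_morphism rc. Proof. by move=> x y; rewrite /rc rmorphB. Qed.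
Lemma rc_is_monoid : monoid_morphism rc.
Proof. by split=> [|x y]; rewrite /rc ?rmorph1 ?rmorphM. Qed.
HB.instance Definition _ := GRing.isZmodMorphism.Build R C rc rc_is_zmod.
HB.instance Definition _ := GRing.isMonoidMorphism.Build R C rc rc_is_monoid.

Lemma mkc_eta (z : C) : z = mkc (re z) (im z).
Proof. by case: z. Qed.

Lemma reD z t : re (z + t) = re z + re t. Proof. by case: z t => [? ?] [? ?]. Qed.
Lemma imD z t : im (z + t) = im z + im t. Proof. by case: z t => [? ?] [? ?]. Qed.
Lemma reN z : re (- z) = - re z. Proof. by case: z. Qed.
Lemma imN z : im (- z) = - im z. Proof. by case: z. Qed.
Lemma reM z t : re (z * t) = re z * re t - im z * im t.
Proof. by case: z t => [? ?] [? ?]. Qed.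
Lemma imM z t : im (z * t) = re z * im t + im z * re t.
Proof. by case: z t => [? ?] [? ?]. Qed.
Lemma re_rcM x z : re (rc x * z) = x * re z.
Proof. by rewrite reM /= mul0r subr0. Qed.
Lemma im_rcM x z : im (rc x * z) = x * im z.
Proof. by rewrite imM /= mul0r addr0. Qed.

Lemma rc_le x y : (rc x <= rc y) = (x <= y). Proof. exact: lecR. Qed.
Lemma rc_lt x y : (rc x < rc y) = (x < y). Proof. exact: ltcR. Qed.

Lemma normc_le_reim (z : C) : `|z| <= rc (`|re z| + `|im z|).
Proof.
rewrite /rc normc_def lecR -[leRHS]ger0_norm ?addr_ge0// -[leRHS]sqrtr_sqr.
rewrite ler_wsqrtr// sqrrD !real_normK ?num_real//.
by rewrite -addrAC lerDl mulrn_wge0 ?mulr_ge0.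
Qed.

Lemma normc_ge_re (z : C) : rc `|re z| <= `|z|.
Proof. exact: normc_ge_Re. Qed.

Lemma normc_ge_im (z : C) : rc `|im z| <= `|z|.
Proof.
by rewrite /rc normc_def lecR -[leLHS]sqrtr_sqr ler_wsqrtr// lerDr sqr_ge0.
Qed.

Lemma normc_rc (x : R) : `|rc x| = rc `|x|.
Proof. by rewrite normc_def /= expr0n addr0 sqrtr_sqr. Qed.

(** The order of [cplx R] compares only numbers with equal imaginary parts, so a positive tolerance
    is automatically real. This is why the epsilon arguments below can run over [R]. *)
Lemma gt0_rcP (e : C) : 0 < e -> exists2 r : R, 0 < r & e = rc r.
Proof.
move: e => [r s]; rewrite ltcE /= => /andP[/eqP -> r0].
by exists r.
Qed.

Lemma continuousR_distP (T : topologicalType) (f : T -> R) (x : T) :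
  {for x, continuous f} <->
  forall e, 0 < e -> \forall y \near x, `|f x - f y| < e.
Proof. exact: (@cvgrPdist_lt R R^o T (nbhs x) (nbhs_filter x) f (f x)). Qed.

Lemma continuousC_distP (T : topologicalType) (f : T -> C) (x : T) :
  {for x, continuous f} <->
  forall e : R, 0 < e -> \forall y \near x, `|f x - f y| < rc e.
Proof.
have E := @cvgrPdist_lt C C^o T (nbhs x) (nbhs_filter x) f (f x).
split=> [/(iffLR E) + e e0|h].
  by apply; rewrite -(rmorph0 rc) rc_lt.
by apply/(iffRL E) => _ /gt0_rcP[r r0 ->]; apply: h.
Qed.

Lemma re_continuous : continuous re.
Proof.
move=> z; apply/continuousR_distP => e e0.
apply/nbhs_normP; exists (rc e); first by rewrite /= -(rmorph0 rc) rc_lt.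
move=> y yz; rewrite -rc_lt; apply: le_lt_trans yz.
by apply: le_trans (normc_ge_re _); rewrite reD reN.
Qed.

Lemma im_continuous : continuous im.
Proof.
move=> z; apply/continuousR_distP => e e0.
apply/nbhs_normP; exists (rc e); first by rewrite /= -(rmorph0 rc) rc_lt.
move=> y yz; rewrite -rc_lt; apply: le_lt_trans yz.
by apply: le_trans (normc_ge_im _); rewrite imD imN.
Qed.

Lemma rc_continuous : continuous rc.
Proof.
move=> x; apply/continuousC_distP => r r0.
apply/nbhs_normP; exists r => // y.
by rewrite -rmorphB normc_rc rc_lt.
Qed.

End ComplexReal.

Lemma continuous_pair (T U V : topologicalType) (f : T -> U) (g : T -> V) (x : T) :
  {for x, continuous f} -> {for x, continuous g} ->
  {for x, continuous (fun y => (f y, g y))}.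
Proof. by move=> cf cg; apply: cvg_pair. Qed.

Lemma continuous_fst (U V : topologicalType) : continuous (@fst U V).
Proof. by move=> x; exact: cvg_fst. Qed.

Lemma continuous_snd (U V : topologicalType) : continuous (@snd U V).
Proof. by move=> x; exact: cvg_snd. Qed.

Section ContinuousOps.
Context {R : realType} {T : topologicalType}.
Local Notation C := (cplx R).
Implicit Types (f g : T -> C) (x : T).

Lemma cont_cst (U : topologicalType) (c : U) x : {for x, continuous (fun _ : T => c)}.
Proof. exact: cvg_cst. Qed.

Lemma cont_id x : {for x, continuous (fun y : T => y)}.
Proof. exact: cvg_id. Qed.

Lemma contD f g x : {for x, continuous f} -> {for x, continuous g} ->
  {for x, continuous (fun y => f y + g y)}.
Proof. by move=> fc gc; apply: cvgD; [exact: fc|exact: gc]. Qed.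

Lemma contN f x : {for x, continuous f} -> {for x, continuous (fun y => - f y)}.
Proof. by move=> fc; apply: cvgN; exact: fc. Qed.

Lemma contB f g x : {for x, continuous f} -> {for x, continuous g} ->
  {for x, continuous (fun y => f y - g y)}.
Proof. by move=> fc gc; apply: cvgB; [exact: fc|exact: gc]. Qed.

Lemma contM f g x : {for x, continuous f} -> {for x, continuous g} ->
  {for x, continuous (fun y => f y * g y)}.
Proof. by move=> fc gc; apply: cvgM; [exact: fc|exact: gc]. Qed.

Lemma contV f x : f x != 0 -> {for x, continuous f} -> {for x, continuous (fun y => (f y)^-1)}.
Proof. by move=> fx fc; apply: cvgV; [exact: fx|exact: fc]. Qed.

Lemma contX f n x : {for x, continuous f} -> {for x, continuous (fun y => f y ^+ n)}.
Proof.
move=> fc; elim: n => [|n IHn]; first exact: cont_cst.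
by rewrite (_ : (fun _ => _) = (fun y => f y * f y ^+ n));
  [exact: contM|apply/funext => y; rewrite exprS].
Qed.

Lemma cont_sum n (f : 'I_n -> T -> C) x : (forall i, {for x, continuous (f i)}) ->
  {for x, continuous (fun y => \sum_i f i y)}.
Proof.
elim: n f => [|n IHn] f fc.
  rewrite (_ : (fun _ => _) = fun=> 0); first exact: cont_cst.
  by apply/funext => y; rewrite big_ord0.
rewrite (_ : (fun _ => _) = fun y => f ord0 y + \sum_i f (lift ord0 i) y).
  by apply: contD => //; exact: IHn.
by apply/funext => y; rewrite big_ord_recl.
Qed.

Lemma cont_comp (U V : topologicalType) (f : T -> U) (g : U -> V) x y :
  {for x, continuous f} -> f x = y -> {for y, continuous g} ->
  {for x, continuous (fun z => g (f z))}.
Proof. by move=> cf <- cg; exact: continuous_comp cf cg. Qed.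

Lemma cont_fst (U V : topologicalType) (f : T -> U * V) x :
  {for x, continuous f} -> {for x, continuous (fun y => (f y).1)}.
Proof. by move=> fc; apply: (cont_comp (g := fst) fc erefl); exact: continuous_fst. Qed.

Lemma cont_snd (U V : topologicalType) (f : T -> U * V) x :
  {for x, continuous f} -> {for x, continuous (fun y => (f y).2)}.
Proof. by move=> fc; apply: (cont_comp (g := snd) fc erefl); exact: continuous_snd. Qed.

Lemma cont_rc (f : T -> R) x : {for x, continuous f} -> {for x, continuous (fun y => rc (f y))}.
Proof. by move=> fc; apply: (cont_comp (g := rc) fc erefl); exact: rc_continuous. Qed.

Lemma cont_neq0 f x : {for x, continuous f} -> f x != 0 -> \forall y \near x, f y != 0.
Proof. by move=> fc fx; apply: (@cvgr_neq0 _ _ _ (nbhs x) _ f (f x)); [exact: fc|exact: fx]. Qed.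

End ContinuousOps.

Lemma near_preimage (T U : topologicalType) (f : T -> U) x y (P : U -> Prop) :
  {for x, continuous f} -> f x = y -> (\forall u \near y, P u) ->
  \forall z \near x, P (f z).
Proof. by move=> fc <-; exact: fc. Qed.

(** * Integrals of complex functions over the unit interval *)

Section UnitIntegral.
Context {R : realType}.
Local Notation C := (cplx R).
Local Notation mu := (@lebesgue_measure R).
Implicit Types g : R -> C.

Definition cint g : C :=
  mkc (\int[mu]_(t in `[0, 1]) re (g t)) (\int[mu]_(t in `[0, 1]) im (g t)).

(** Continuity is two-sided even at 0 and 1: the integrands are given by formulas that still make
    sense slightly outside [0, 1], which avoids subspace topologies. *)
Definition ccont g := forall t : R, 0 <= t <= 1 -> {for t, continuous g}.

Lemma cont01_integrable (h : R -> R) :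
  (forall t : R, 0 <= t <= 1 -> {for t, continuous h}) ->
  mu.-integrable `[0, 1] (EFin \o h).
Proof.
move=> hc; apply: continuous_compact_integrable; first exact: segment_compact.
apply: continuous_in_subspaceT => t; rewrite inE /= in_itv /=; exact: hc.
Qed.

Lemma ccont_re g t : {for t, continuous g} -> {for t, continuous (fun t => re (g t))}.
Proof. by move=> gt; apply: continuous_comp gt _; exact: re_continuous. Qed.

Lemma ccont_im g t : {for t, continuous g} -> {for t, continuous (fun t => im (g t))}.
Proof. by move=> gt; apply: continuous_comp gt _; exact: im_continuous. Qed.

Lemma re_integrable g : ccont g -> mu.-integrable `[0, 1] (EFin \o (fun t => re (g t))).
Proof. by move=> gc; apply: cont01_integrable => t /gc /ccont_re. Qed.

Lemma im_integrable g : ccont g -> mu.-integrable `[0, 1] (EFin \o (fun t => im (g t))).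
Proof. by move=> gc; apply: cont01_integrable => t /gc /ccont_im. Qed.

Lemma ccontD g1 g2 : ccont g1 -> ccont g2 -> ccont (fun t => g1 t + g2 t).
Proof. by move=> c1 c2 t t01; apply: cvgD; [exact: c1|exact: c2]. Qed.

Lemma ccontM g1 g2 : ccont g1 -> ccont g2 -> ccont (fun t => g1 t * g2 t).
Proof. by move=> c1 c2 t t01; apply: cvgM; [exact: c1|exact: c2]. Qed.

Lemma ccont_cst c : ccont (fun=> c).
Proof. by move=> t t01; exact: cvg_cst. Qed.

Lemma eq_cint g1 g2 : (forall t, 0 <= t <= 1 -> g1 t = g2 t) -> cint g1 = cint g2.
Proof.
move=> e; congr mkc; apply: eq_Rintegral => t;
  by rewrite inE /= in_itv /= => /e ->.
Qed.

Lemma cintD g1 g2 : ccont g1 -> ccont g2 ->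
  cint (fun t => g1 t + g2 t) = cint g1 + cint g2.
Proof.
move=> c1 c2; rewrite [RHS]mkc_eta reD imD; congr mkc.
  under eq_Rintegral do rewrite reD.
  by rewrite RintegralD//; exact: re_integrable.
under eq_Rintegral do rewrite imD.
by rewrite RintegralD//; exact: im_integrable.
Qed.

Lemma cintZl c g : ccont g -> cint (fun t => c * g t) = c * cint g.
Proof.
move=> gc; rewrite [RHS]mkc_eta reM imM; congr mkc.
  under eq_Rintegral do rewrite reM -mulNr.
  rewrite RintegralD//=; first by rewrite !RintegralZl ?mulNr//; [exact: im_integrable|exact: re_integrable].
    by apply: cont01_integrable => t /gc /ccont_re h; apply: cvgM => //; exact: cvg_cst.
  by apply: cont01_integrable => t /gc /ccont_im h; apply: cvgM => //; exact: cvg_cst.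
under eq_Rintegral do rewrite imM.
rewrite RintegralD//=; first by rewrite !RintegralZl//; [exact: re_integrable|exact: im_integrable].
  by apply: cont01_integrable => t /gc /ccont_im h; apply: cvgM => //; exact: cvg_cst.
by apply: cont01_integrable => t /gc /ccont_re h; apply: cvgM => //; exact: cvg_cst.
Qed.

Lemma cintB g1 g2 : ccont g1 -> ccont g2 ->
  cint (fun t => g1 t - g2 t) = cint g1 - cint g2.
Proof.
move=> c1 c2; have := @cintD g1 (fun t => -1 * g2 t) c1 (ccontM (@ccont_cst (-1)) c2).
rewrite cintZl// mulN1r => <-; apply: eq_cint => t _; by rewrite mulN1r.
Qed.

Lemma cint_cst c : cint (fun=> c) = c.
Proof.
have E (r : R) : \int[mu]_(t in `[0, 1]) r = r.
  by rewrite Rintegral_cst//= lebesgue_measure_itv/= lte_fin ltr01 oppr0 adde0 mulr1.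
by rewrite [RHS]mkc_eta /cint !E.
Qed.

Lemma ccont_sum n (g : 'I_n -> R -> C) : (forall i, ccont (g i)) ->
  ccont (fun t => \sum_i g i t).
Proof.
elim: n g => [|n IHn] g gc.
  suff -> : (fun t => \sum_i g i t) = fun=> 0 by exact: ccont_cst.
  by apply/funext => t; rewrite big_ord0.
suff -> : (fun t => \sum_i g i t) = fun t => g ord0 t + \sum_i g (lift ord0 i) t.
  by apply: ccontD => //; exact: IHn.
by apply/funext => t; rewrite big_ord_recl.
Qed.

Lemma cint_sum n (g : 'I_n -> R -> C) : (forall i, ccont (g i)) ->
  cint (fun t => \sum_i g i t) = \sum_i cint (g i).
Proof.
elim: n g => [|n IHn] g gc.
  by rewrite big_ord0 -[RHS](cint_cst 0); apply: eq_cint => t _; rewrite big_ord0.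
rewrite big_ord_recl -IHn// -cintD//; last exact: ccont_sum.
by apply: eq_cint => t _; rewrite big_ord_recl.
Qed.

Lemma Rint_bound (h : R -> R) (e : R) :
  (forall t : R, 0 <= t <= 1 -> {for t, continuous h}) ->
  (forall t, 0 <= t <= 1 -> `|h t| <= e) -> `|\int[mu]_(t in `[0, 1]) h t| <= e.
Proof.
move=> hc he; apply: (le_trans (le_normr_Rintegral _ _)) => //.
  exact: cont01_integrable.
have -> : e = \int[mu]_(t in `[0, 1]) e.
  by rewrite Rintegral_cst//= lebesgue_measure_itv/= lte_fin ltr01 oppr0 adde0 mulr1.
apply: le_Rintegral => //=.
- by apply: cont01_integrable => t /hc; exact: cvg_norm.
- by apply: cont01_integrable => t _; exact: cvg_cst.
Qed.

(* The factor 2 comes from bounding real and imaginary parts separately. *)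
Lemma cint_bound g (e : R) : ccont g ->
  (forall t, 0 <= t <= 1 -> `|g t| <= rc e) -> `|cint g| <= rc (e *+ 2).
Proof.
move=> gc ge; apply: le_trans (normc_le_reim _) _; rewrite rc_le mulr2n.
apply: lerD.
  apply: Rint_bound => [t /gc/ccont_re//|t /ge].
  by rewrite -rc_le; apply: le_trans; exact: normc_ge_re.
apply: Rint_bound => [t /gc/ccont_im//|t /ge].
by rewrite -rc_le; apply: le_trans; exact: normc_ge_im.
Qed.

(** The derivative of [g] is given by a quotient continuous at 0, the form in which derivatives of
    complex functions along real paths arise below. The real theorem is applied to the real and
    imaginary parts. *)
Lemma cint_FTC (g dg : R -> C) : ccont dg ->
  (forall t : R, 0 <= t <= 1 -> exists q : R -> C,
    [/\ {for 0, continuous q}, q 0 = dg t &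
        \forall k \near (0 : R), g (t + k) = g t + rc k * q k]) ->
  cint dg = g 1 - g 0.
Proof.
move=> dgc gq.
(* Both parts are treated at once through an arbitrary continuous real-linear form [p], which
   commutes with the difference quotients. *)
have FTC (p : C -> R) : (forall x z, p (rc x * z) = x * p z) ->
    (forall x y, p (x + y) = p x + p y) -> continuous p ->
    \int[mu]_(t in `[0, 1]) p (dg t) = p (g 1) - p (g 0).
  move=> pZ pD pc.
  have pcd (t : R) : 0 <= t <= 1 -> {for t, continuous (fun t => p (dg t))}.
    by move=> /dgc h; apply: continuous_comp h _; exact: pc.
  have pd (t : R) : 0 <= t <= 1 -> is_derive t (1 : R) (fun t => p (g t)) (p (dg t)).
    move=> /gq [q [q0 <- qE]].
    have L : h^-1 *: (((fun t => p (g t)) \o shift t) (h *: (1 : R)) - p (g t))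
        @[h --> (0 : R)^'] --> p (q 0).
      apply: (@cvg_trans _ (p (q h) @[h --> (0 : R)^'])).
        apply: near_eq_cvg; near=> h => /=.
        rewrite [h *: 1]mulr1 [h + t]addrC.
        have -> : g (t + h) = g t + rc h * q h by near: h; by apply: nbhs_dnbhs; exact: qE.
        rewrite pD pZ [_ + h * _]addrC addrK [_ *: _]mulrA mulVf ?mul1r//.
        by near: h; exact: nbhs_dnbhs_neq.
      have pq : {for (0 : R), continuous (fun h => p (q h))}.
        by apply: continuous_comp q0 _; exact: pc.
      by move/continuous_withinNx : pq.
    by apply: DeriveDef; [apply/cvg_ex; exists (p (q 0))|exact/cvg_lim].
  have pgc (t : R) : 0 <= t <= 1 -> {for t, continuous (fun t => p (g t))}.
    move=> /pd h; apply: differentiable_continuous.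
    by apply/derivable1_diffP; apply: ex_derive.
  rewrite /Rintegral (@continuous_FTC2 _ _ (fun t => p (g t)))//.
  - by apply: continuous_in_subspaceT => t; rewrite inE /= in_itv /=; exact: pcd.
  - split.
    + move=> t; rewrite in_itv /= => /andP[t0 t1].
      by have [] := pd t; rewrite ?(ltW t0) ?(ltW t1).
    + by apply: cvg_at_right_filter; apply: pgc; rewrite lexx ler01.
    + by apply: cvg_at_left_filter; apply: pgc; rewrite lexx ler01.
  - move=> t; rewrite in_itv /= => /andP[t0 t1].
    by rewrite derive1E; apply: derive_val; apply: pd; rewrite (ltW t0) (ltW t1).
rewrite [RHS]mkc_eta reD imD reN imN; congr mkc; apply: FTC.
- exact: re_rcM.
- exact: reD.
- exact: re_continuous.
- exact: im_rcM.
- exact: imD.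
- exact: im_continuous.
Unshelve. all: by end_near. Qed.

(** Compactness of [0, 1] turns joint continuity along {p} x [0, 1] into uniform closeness of the
    integrands for v near p. The same argument shows that [O] contains {v} x [0, 1] for such v, so
    that the integrals there are those of continuous functions. *)
Lemma cint_continuous (V : topologicalType) (O : set (V * R)) (K : V -> R -> C) (p : V) :
  open O -> (forall t : R, 0 <= t <= 1 -> O (p, t)) ->
  (forall z, O z -> {for z, continuous (fun z => K z.1 z.2)}) ->
  {for p, continuous (fun v => cint (K v))}.
Proof.
move=> oO pO Kc; apply/continuousC_distP => e e0.
have cI : compact `[(0 : R), 1]%classic by exact: segment_compact.
have /compact_near_coveringP cov := cI.
(* The tolerance is e / 4 because [cint_bound] doubles it, leaving e / 2 < e; it is halved once more
   for the triangle inequality through [K p t]. *)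
have key (t : R) : 0 <= t <= 1 ->
    nbhs (t, p) [set x : R * V | O (x.2, x.1) /\ `|K p x.1 - K x.2 x.1| < rc (e / 4)].
  move=> t01; have e4 : 0 < e / 4 / 2 by lra.
  have Oz : \forall z \near (p, t), O z by apply: open_nbhs_nbhs; split=> //; exact: pO.
  have /continuousC_distP/(_ _ e4) Kz := Kc _ (pO t t01).
  have cpt : {for (t, p), continuous (fun x : R * V => (p, x.1))}.
    by apply: continuous_pair; [exact: cvg_cst|exact: continuous_fst].
  have csw : {for (t, p), continuous (fun x : R * V => (x.2, x.1))}.
    by apply: continuous_pair; [exact: continuous_snd|exact: continuous_fst].
  have h1 : nbhs (t, p) [set x : R * V | `|K p t - K p x.1| < rc (e / 4 / 2)] := cpt _ Kz.
  have h2 : nbhs (t, p) [set x : R * V | `|K p t - K x.2 x.1| < rc (e / 4 / 2)] := csw _ Kz.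
  have h3 : nbhs (t, p) [set x : R * V | O (x.2, x.1)] := csw _ Oz.
  have FF : Filter (nbhs ((t, p) : (R * V)%type)) by exact: nbhs_filter.
  refine (@filterS _ _ FF _ _ _ (@filterI _ _ FF _ _ h1 (@filterI _ _ FF _ _ h2 h3))).
  move=> -[t' v] /= [{}h1 [{}h2 {}h3]]; split=> //.
  have -> : K p t' - K v t' = (K p t' - K p t) + (K p t - K v t') by ring.
  apply: le_lt_trans (ler_normD _ _) _.
  rewrite [e / 4](_ : _ = e / 4 / 2 + e / 4 / 2); last by field.
  by rewrite rmorphD distrC; apply: ltrD.
have : \forall v \near p, `[(0 : R), 1]%classic `<=`
    [set t | O (v, t) /\ `|K p t - K v t| < rc (e / 4)].
  apply: (cov V (nbhs p) (fun v t => O (v, t) /\ `|K p t - K v t| < rc (e / 4)) _) => t.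
  by rewrite /= in_itv /=; exact: key.
apply: filterS => v H.
have vO t : 0 <= t <= 1 -> O (v, t) by move=> h; apply H; rewrite /= in_itv.
have cK u : (forall t, 0 <= t <= 1 -> O (u, t)) -> ccont (K u).
  move=> uO t /uO /Kc h.
  apply: (@continuous_comp _ _ _ (fun t => (u, t)) (fun z => K z.1 z.2)) h.
  by apply: continuous_pair; [exact: cvg_cst|exact: cvg_id].
rewrite -cintB; [|exact: cK|exact: cK].
apply: (@le_lt_trans _ _ (rc ((e / 4) *+ 2))); last by rewrite rc_lt; lra.
apply: cint_bound.
  by move=> t t01; apply: cvgB; [exact: (cK p pO)|exact: (cK v vO)].
by move=> t t01; apply: ltW; apply H; rewrite /= in_itv.
Qed.

End UnitIntegral.

(** * Complex derivatives in one variable *)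

Section ComplexDerivative.
Context {R : realType}.
Local Notation C := (cplx R).
Implicit Types (h : C -> C) (x d : C).

(* Caratheodory's form of complex differentiability. *)
Definition cderiv h x d := exists q : C -> C,
  [/\ {for 0, continuous q}, q 0 = d & \forall k \near (0 : C), h (x + k) = h x + k * q k].

Lemma derivable_quotient (K : numFieldType) (V : normedModType K) (F : V -> K) (p v : V) :
  derivable F p v -> exists q : K -> K,
    [/\ {for 0, continuous q}, q 0 = 'D_v F p & forall k, F (p + k *: v) = F p + k * q k].
Proof.
move=> dF; exists (fun k => if k == 0 then 'D_v F p else k^-1 * (F (p + k *: v) - F p)).
split; last 2 first.
- by rewrite eqxx.
- move=> k; case: eqVneq => [->|k0]; first by rewrite scale0r mul0r !addr0.
  by rewrite mulrA mulfV// mul1r addrCA subrr addr0.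
apply/continuous_withinNx; rewrite eqxx.
have := dF; rewrite /derivable => /cvg_ex[l Fl].
have -> : 'D_v F p = l by apply/cvg_lim.
apply: cvg_trans Fl; apply: near_eq_cvg; near=> k => /=.
have /negPf -> : k != 0 by near: k; exact: nbhs_dnbhs_neq.
by rewrite [_ + p]addrC.
Unshelve. all: by end_near. Qed.

Lemma continuous_idM (q : C -> C) : {for 0, continuous q} ->
  {for 0, continuous (fun k : C => k * q k)}.
Proof. by move=> qc; apply: contM; [exact: cont_id|exact: qc]. Qed.

Lemma cderiv_continuous h x d : cderiv h x d -> {for x, continuous h}.
Proof.
move=> [q [q0 _ qE]]; apply/continuousC_distP => e e0.
have c := continuous_idM q0.
have /continuousC_distP/(_ e e0) := c; rewrite mul0r => kq.
have sh : {for x, continuous (fun y : C => y - x)} by apply: contB; [exact: cont_id|exact: cont_cst].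
have qE' := near_preimage sh (subrr x) qE.
have kq' := near_preimage sh (subrr x) kq.
near=> y.
have -> : h y = h x + (y - x) * q (y - x).
  by rewrite -[in LHS](subrK x y) addrC; near: y.
rewrite (_ : _ - _ = 0 - (y - x) * q (y - x)); last by ring.
by near: y.
Unshelve. all: by end_near. Qed.

Lemma cderiv_cst c x : cderiv (fun=> c) x 0.
Proof.
by exists (fun=> 0); split; [exact: cont_cst|by []|near=> k; rewrite mulr0 addr0].
Unshelve. all: by end_near. Qed.

Lemma cderiv_id x : cderiv id x 1.
Proof.
by exists (fun=> 1); split; [exact: cont_cst|by []|near=> k; rewrite mulr1].
Unshelve. all: by end_near. Qed.

Lemma cderivD h1 h2 x d1 d2 : cderiv h1 x d1 -> cderiv h2 x d2 ->
  cderiv (fun y => h1 y + h2 y) x (d1 + d2).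
Proof.
move=> [q1 [c1 <- E1]] [q2 [c2 <- E2]]; exists (fun k => q1 k + q2 k); split; [exact: (contD c1 c2)|by []|].
near=> k; have -> : h1 (x + k) = h1 x + k * q1 k by near: k.
have -> : h2 (x + k) = h2 x + k * q2 k by near: k.
by ring.
Unshelve. all: by end_near. Qed.

Lemma cderivM h1 h2 x d1 d2 : cderiv h1 x d1 -> cderiv h2 x d2 ->
  cderiv (fun y => h1 y * h2 y) x (d1 * h2 x + h1 x * d2).
Proof.
move=> [q1 [c1 <- E1]] [q2 [c2 <- E2]].
exists (fun k : C => q1 k * (h2 x + k * q2 k) + h1 x * q2 k); split.
- apply: contD; last by apply: contM; [exact: cont_cst|exact: c2].
  by apply: contM; [exact: c1|apply: contD; [exact: cont_cst|exact: continuous_idM]].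
- by rewrite mul0r addr0.
near=> k; have -> : h1 (x + k) = h1 x + k * q1 k by near: k.
have -> : h2 (x + k) = h2 x + k * q2 k by near: k.
by ring.
Unshelve. all: by end_near. Qed.

Lemma cderivV h x d : h x != 0 -> cderiv h x d -> cderiv (fun y => (h y)^-1) x (- d / h x ^+ 2).
Proof.
move=> hx0 dh; have hc := cderiv_continuous dh; case: dh => [q [c <- E]].
have c' : {for (0 : C), continuous (fun k : C => h x + k * q k)}.
  by apply: contD; [exact: cont_cst|exact: continuous_idM].
exists (fun k : C => - q k / (h x * (h x + k * q k))); split.
- apply: contM; first exact: (contN c).
  by apply: contV; [rewrite mul0r addr0 mulf_neq0|apply: contM; [exact: cont_cst|exact: c']].
- by rewrite mul0r addr0 expr2.
have nz : \forall k \near (0 : C), h x + k * q k != 0.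
  by apply: (cont_neq0 c'); rewrite mul0r addr0.
near=> k; have -> : h (x + k) = h x + k * q k by near: k.
have k0 : h x + k * q k != 0 by near: k.
by field; rewrite hx0 k0.
Unshelve. all: by end_near. Qed.

Lemma cderivX n x : cderiv (fun y => y ^+ n) x (n%:R * x ^+ n.-1).
Proof.
elim: n => [|n IHn].
  rewrite mul0r; have := cderiv_cst 1 x.
  by congr cderiv.
have := cderivM (cderiv_id x) IHn.
have -> : 1 * x ^+ n + id x * (n%:R * x ^+ n.-1) = n.+1%:R * x ^+ n.+1.-1.
  case: n {IHn} => [|n] /=; first by rewrite !expr0; ring.
  by rewrite -[n.+2%:R]natr1 exprS; ring.
rewrite (_ : (fun y : C => id y * y ^+ n) = (fun y => y ^+ n.+1))//.
by apply/funext => y; rewrite exprS.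
Qed.

Lemma cderiv_sum n (h d : 'I_n -> C -> C) x : (forall i, cderiv (h i) x (d i x)) ->
  cderiv (fun y => \sum_i h i y) x (\sum_i d i x).
Proof.
elim: n h d => [|n IHn] h d hd.
  rewrite big_ord0 (_ : (fun y => _) = fun=> 0); first exact: cderiv_cst.
  by apply/funext => y; rewrite big_ord0.
rewrite big_ord_recl (_ : (fun y => _) = fun y => h ord0 y + \sum_i h (lift ord0 i) y).
  apply: cderivD; first exact: hd.
  by apply: (IHn (fun i => h (lift ord0 i)) (fun i => d (lift ord0 i))) => i; exact: hd.
by apply/funext => y; rewrite big_ord_recl.
Qed.

(* For h = g', this is Hadamard's quotient (g (x + k) - g x) / k.  It depends
   continuously on x, k and further parameters, so that differentiating an
   integral of g reduces to the continuity of parametric integrals. *)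
Definition segment_mean h x k := cint (fun t => h (x + rc t * k)).

Lemma segment_continuous x k t : {for t, continuous (fun t : R => x + rc t * k)}.
Proof.
apply: contD; first exact: cont_cst.
by apply: contM; [exact: rc_continuous|exact: cont_cst].
Qed.

Lemma segment_mean0 h x : segment_mean h x 0 = h x.
Proof. by rewrite -[RHS]cint_cst; apply: eq_cint => t _; rewrite mulr0 addr0. Qed.

Lemma segment_meanE h dh x k :
  (forall t, 0 <= t <= 1 -> cderiv h (x + rc t * k) (dh (x + rc t * k))) ->
  (forall t, 0 <= t <= 1 -> {for x + rc t * k, continuous dh}) ->
  h (x + k) = h x + k * segment_mean dh x k.
Proof.
move=> hd dc.
have sc t : 0 <= t <= 1 -> {for t, continuous (fun t => dh (x + rc t * k))}.
  by move=> t01; exact: (cont_comp (@segment_continuous x k t) erefl (dc t t01)).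
rewrite /segment_mean -cintZl//.
rewrite (@cint_FTC _ (fun t => h (x + rc t * k))) /=.
- by rewrite rmorph1 rmorph0 mul1r mul0r addr0 addrCA subrr addr0.
- by move=> t t01; apply: contM; [exact: cont_cst|exact: sc].
move=> t t01; have [q [qc q0 qE]] := hd t t01.
have kc : {for (0 : R), continuous (fun u : R => rc u * k)}.
  by apply: contM; [exact: rc_continuous|exact: cont_cst].
have k0 : rc 0 * k = 0 by rewrite rmorph0 mul0r.
exists (fun u : R => k * q (rc u * k)); split.
- apply: contM; first exact: cont_cst.
  exact: (cont_comp kc k0 qc).
- by rewrite k0 q0.
have qE' := near_preimage kc k0 qE.
near=> u; rewrite rmorphD mulrDl addrA mulrA.
by near: u.
Unshelve. all: by end_near. Qed.

(** The parameter in [P] will be x when the quotient is taken in y: quotients of f(x, .) must be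
    continuous in x as well, since x runs over a circle of integration. *)
Lemma segment_mean_continuous (P : topologicalType) (dh : P -> C -> C) (D : set (P * C)) p x k :
  open D -> (forall z, D z -> {for z, continuous (fun z => dh z.1 z.2)}) ->
  (forall t, 0 <= t <= 1 -> D (p, x + rc t * k)) ->
  {for (p, x, k), continuous (fun z => segment_mean (dh z.1.1) z.1.2 z.2)}.
Proof.
move=> oD Dc seg.
pose s (z : P * C * C * R) : P * C := (z.1.1.1, z.1.1.2 + rc z.2 * z.1.2).
have sc z : {for z, continuous s}.
  have c1 := @continuous_fst (P * C * C)%type R z.
  have c2 : {for z, continuous (fun z : P * C * C * R => z.1.1)}.
    by apply: (cont_comp c1 erefl); exact: continuous_fst.
  apply: continuous_pair; first by apply: (cont_comp c2 erefl); exact: continuous_fst.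
  apply: contD; first by apply: (cont_comp c2 erefl); exact: continuous_snd.
  apply: contM; last by apply: (cont_comp c1 erefl); exact: continuous_snd.
  by apply: cont_rc; exact: continuous_snd.
apply: (@cint_continuous _ _ (s @^-1` D)
  (fun (z : P * C * C) t => dh z.1.1 (z.1.2 + rc t * z.2))).
- by apply: open_comp => // z _; exact: sc.
- by move=> t /seg.
- move=> z /Dc zc; exact: (@cont_comp _ _ _ s (fun z => dh z.1 z.2) z _ (sc z) erefl zc).
Qed.

End ComplexDerivative.

(** * Means over circles *)

Section Circle.
Context {R : realType}.
Local Notation C := (cplx R).
Implicit Types (h : C -> C) (x d : C).

Definition circ (t : R) : C := mkc (cos (2 * pi * t)) (sin (2 * pi * t)).
Definition two_pi_i : C := mkc 0 (2 * pi).

Lemma circ0 : circ 0 = 1.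
Proof. by rewrite /circ mulr0 cos0 sin0. Qed.

Lemma circ1 : circ 1 = 1.
Proof. by rewrite /circ mulr1 mulr_natl cos2pi sin2pi. Qed.

Lemma normc_circ t : `|circ t| = 1.
Proof. by rewrite normc_def /= cos2Dsin2 sqrtr1. Qed.

Lemma circ_neq0 t : circ t != 0.
Proof. by rewrite -normr_eq0 normc_circ oner_neq0. Qed.

Lemma two_pi_i_neq0 : two_pi_i != 0.
Proof.
by apply/eqP => /(congr1 im) /= /eqP; rewrite mulf_eq0 pnatr_eq0 /= gt_eqF ?pi_gt0.
Qed.

Lemma circ_quotient (t : R) : exists q : R -> C,
  [/\ {for 0, continuous q}, q 0 = two_pi_i * circ t & forall k, circ (t + k) = circ t + rc k * q k].
Proof.
have dc : is_derive t (1 : R) (fun t => cos (2 * pi * t)) (- (2 * pi) * sin (2 * pi * t)).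
  by apply: is_derive_eq; rewrite /GRing.scale /=; ring.
have ds : is_derive t (1 : R) (fun t => sin (2 * pi * t)) ((2 * pi) * cos (2 * pi * t)).
  by apply: is_derive_eq; rewrite /GRing.scale /=; ring.
have [q1 [c1 e1 E1]] := derivable_quotient (@ex_derive _ _ _ _ _ _ _ dc).
have [q2 [c2 e2 E2]] := derivable_quotient (@ex_derive _ _ _ _ _ _ _ ds).
rewrite (@derive_val _ _ _ _ _ _ _ dc) in e1.
rewrite (@derive_val _ _ _ _ _ _ _ ds) in e2.
exists (fun k => rc (q1 k) + mkc 0 1 * rc (q2 k)); split.
- apply: contD; first exact: cont_rc.
  by apply: contM; [exact: cont_cst|exact: cont_rc].
- rewrite e1 e2 [LHS]mkc_eta [RHS]mkc_eta; congr mkc; rewrite !(reD, imD, reM, imM) /=; ring.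
move=> k; rewrite /circ.
have := E1 k; have := E2 k; rewrite /GRing.scale /= mulr1 => -> ->.
rewrite [LHS]mkc_eta [RHS]mkc_eta; congr mkc; rewrite !(reD, imD, reM, imM) /=; ring.
Qed.

Lemma circ_continuous t : {for t, continuous circ}.
Proof.
have c : {for t, continuous (fun t : R => 2 * pi * t)}.
  by apply: cvgM; [exact: cvg_cst|exact: cvg_id].
rewrite (_ : circ = fun t => rc (cos (2 * pi * t)) + mkc 0 1 * rc (sin (2 * pi * t))).
  apply: contD; first by apply: cont_rc; apply: (cont_comp c erefl); exact: continuous_cos.
  apply: contM; first exact: cont_cst.
  by apply: cont_rc; apply: (cont_comp c erefl); exact: continuous_sin.
apply/funext => u; rewrite /circ [RHS]mkc_eta; congr mkc; rewrite !(reD, imD, reM, imM) /=; ring.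
Qed.

Lemma cont_circ (T : topologicalType) (f : T -> R) (x : T) :
  {for x, continuous f} -> {for x, continuous (fun y => circ (f y))}.
Proof. by move=> fc; apply: (cont_comp (g := circ) fc erefl); exact: circ_continuous. Qed.

Lemma cont_circ_scaled (r t : R) : {for t, continuous (fun t : R => rc r * circ t)}.
Proof. by apply: contM; [exact: cont_cst|exact: circ_continuous]. Qed.

Lemma rc_circ_neq0 (r : R) t : r != 0 -> rc r * circ t != 0.
Proof. by move=> r0; rewrite mulf_neq0 ?circ_neq0// -(rmorph0 rc) (inj_eq (@complexI R)). Qed.

(* Up to the factor 2 pi i r, the integrand is the derivative of
   t |-> h (r e^(2 pi i t)). *)
Lemma circ_integral_deriv h dh (r : R) : r != 0 ->
  (forall t, 0 <= t <= 1 -> cderiv h (rc r * circ t) (dh (rc r * circ t))) ->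
  (forall t, 0 <= t <= 1 -> {for rc r * circ t, continuous dh}) ->
  cint (fun t => circ t * dh (rc r * circ t)) = 0.
Proof.
move=> r0 hd dc.
have cc t : {for t, continuous (fun t => rc r * circ t)} := @cont_circ_scaled r t.
have gc : ccont (fun t => circ t * dh (rc r * circ t)).
  move=> t t01; apply: contM; first exact: circ_continuous.
  exact: (cont_comp (cc t) erefl (dc t t01)).
have : cint (fun t => (rc r * two_pi_i) * (circ t * dh (rc r * circ t))) =
    h (rc r * circ 1) - h (rc r * circ 0).
  apply: (@cint_FTC _ (fun t => h (rc r * circ t))).
    by apply: ccontM; [exact: ccont_cst|exact: gc].
  move=> t t01; have [q [qc q0 qE]] := hd t t01; have [p [pc p0 pE]] := circ_quotient t.
  have c : {for 0, continuous (fun k => rc r * (rc k * p k))}.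
    apply: contM; first exact: cont_cst.
    by apply: contM; [exact: rc_continuous|exact: pc].
  have c0 : rc r * (rc 0 * p 0) = 0 by rewrite rmorph0 mul0r mulr0.
  exists (fun k => rc r * p k * q (rc r * (rc k * p k))); split.
  - apply: contM; first by apply: contM; [exact: cont_cst|exact: pc].
    exact: (cont_comp c c0 qc).
  - by rewrite c0 q0 p0; ring.
  near=> k; rewrite pE mulrDr.
  have -> : h (rc r * circ t + rc r * (rc k * p k)) =
     h (rc r * circ t) + rc r * (rc k * p k) * q (rc r * (rc k * p k)).
    by near: k; exact: (near_preimage c c0 qE).
  by ring.
rewrite circ0 circ1 subrr cintZl; last exact: gc.
move=> /eqP; rewrite mulf_eq0 mulf_eq0 (negPf two_pi_i_neq0).
by rewrite -(rmorph0 rc) (inj_eq (@complexI R)) (negPf r0) /= => /eqP.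
Unshelve. all: by end_near. Qed.

Lemma itvoo_convex (a b x y v : R) : a < x < b -> a < y < b -> 0 <= v <= 1 ->
  a < (1 - v) * x + v * y < b.
Proof.
move=> /andP[? ?] /andP[? ?] /andP[v0 v1].
have [v1'|v1'] := ltP v 1; last first.
  have -> : v = 1 by lra.
  by apply/andP; split; lra.
have w0 : 0 < 1 - v by lra.
have d1 : 0 < x - a by lra.
have d2 : 0 <= y - a by lra.
have d3 : 0 < b - x by lra.
have d4 : 0 <= b - y by lra.
have := mulr_gt0 w0 d1; have := mulr_ge0 v0 d2.
have := mulr_gt0 w0 d3; have := mulr_ge0 v0 d4.
by move=> ? ? ? ?; apply/andP; split; lra.
Qed.

(** The derivative of the mean over the circle of radius rho in rho is the integral of e^(2 pi i t)
    h'(rho e^(2 pi i t)), which vanishes because the integrand is, up to a constant, the derivative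
    of a function with equal values at both ends of the loop. Only an annulus is involved, so [h]
    may be singular at 0. *)
Lemma circ_integral_radius h dh (A : set C) (a b r1 r2 : R) : open A -> 0 <= a ->
  (forall r t, a < r < b -> A (rc r * circ t)) ->
  (forall x, A x -> cderiv h x (dh x)) ->
  (forall x, A x -> {for x, continuous dh}) ->
  a < r1 < b -> a < r2 < b ->
  cint (fun t => h (rc r1 * circ t)) = cint (fun t => h (rc r2 * circ t)).
Proof.
move=> oA a0 Aab hd dc r1ab r2ab.
pose s := r2 - r1; pose rho u := r1 + u * s.
have rhoab u : 0 <= u <= 1 -> a < rho u < b.
  move=> u01; have -> : rho u = (1 - u) * r1 + u * r2 by rewrite /rho /s; ring.
  exact: itvoo_convex.
have hc x : A x -> {for x, continuous h} by move=> /hd /cderiv_continuous.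
pose M u := cint (fun t => h (rc (rho u) * circ t)).
have -> : cint (fun t => h (rc r1 * circ t)) = M 0.
  by apply: eq_cint => t _; rewrite /rho mul0r addr0.
have -> : cint (fun t => h (rc r2 * circ t)) = M 1.
  by apply: eq_cint => t _; rewrite /rho /s mul1r addrC subrK.
apply/eqP; rewrite eq_sym -subr_eq0; apply/eqP.
rewrite -(@cint_FTC _ M (fun=> 0)); [exact: cint_cst|exact: ccont_cst|].
move=> u u01; have := rhoab u u01 => /andP[au ub].
(* The difference quotient of [M] at u, obtained by applying Hadamard's formula to [h] under the
   integral; the point on the circle moves by k s e^(2 pi i t). *)
pose q (k : R) := cint (fun t => (rc s * circ t) *
  segment_mean dh (rc (rho u) * circ t) (rc k * (rc s * circ t))).
(* The intermediate points lie on the same ray, at radii between rho u and rho (u + k), hence inside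
   the annulus. *)
have near_in k : a < rho (u + k) < b -> forall t v, 0 <= v <= 1 ->
    A (rc (rho u) * circ t + rc v * (rc k * (rc s * circ t))).
  move=> kab t v v01.
  have -> : rc (rho u) * circ t + rc v * (rc k * (rc s * circ t)) =
      rc (rho (u + v * k)) * circ t.
    by rewrite /rho !(rmorphD, rmorphM) /=; ring.
  have -> : rho (u + v * k) = (1 - v) * rho u + v * rho (u + k) by rewrite /rho; ring.
  by apply: Aab; apply: itvoo_convex; rewrite // au.
have rhoc : {for 0, continuous (fun k => rho (u + k))}.
  apply: cvgD; first exact: cvg_cst.
  by apply: cvgM; [apply: cvgD; [exact: cvg_cst|exact: cvg_id]|exact: cvg_cst].
have cc (k : R) t : a < rho (u + k) < b ->
    {for (k, t), continuous (fun z => segment_mean dh (rc (rho u) * circ z.2) (rc z.1 * (rc s * circ z.2)))}.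
  move=> kab.
  have c2 : {for (k, t), continuous (fun z : R * R => circ z.2)}.
    by apply: cont_circ; exact: continuous_snd.
  have cp : {for (k, t), continuous (fun z : R * R =>
      ((0 : R), rc (rho u) * circ z.2, rc z.1 * (rc s * circ z.2)))}.
    apply: continuous_pair; first apply: continuous_pair; first exact: cont_cst.
    - by apply: contM; [exact: cont_cst|exact: c2].
    - apply: contM; first by apply: cont_rc; exact: continuous_fst.
      by apply: contM; [exact: cont_cst|exact: c2].
  apply: (cont_comp (g := fun z : R * C * C => segment_mean dh z.1.2 z.2) cp erefl).
  apply: (@segment_mean_continuous _ R (fun=> dh) (snd @^-1` A)).
  - by apply: open_comp; [move=> z _; exact: continuous_snd|exact: oA].
  - by move=> z /dc zc; apply: (cont_comp (f := snd) _ erefl zc); exact: continuous_snd.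
  - by move=> v v01; exact: near_in.
exists q; split.
- apply: (@cint_continuous _ R [set z | a < rho (u + z.1) < b] (fun k t => rc s * circ t *
   segment_mean dh (rc (rho u) * circ t) (rc k * (rc s * circ t)))).
  + rewrite (_ : [set _ | _] = (fun z : R * R => rho (u + z.1)) @^-1` `]a, b[%classic).
      apply: open_comp; last exact: interval_open.
      move=> z _; apply: cvgD; first exact: cvg_cst.
      apply: cvgM; last exact: cvg_cst.
      by apply: cvgD; [exact: cvg_cst|exact: continuous_fst].
    by apply/seteqP; split=> z /=; rewrite in_itv.
  + by move=> t _ /=; rewrite addr0 au.
  + move=> [k t] /= kab; apply: contM; last exact: cc.
    apply: contM; first exact: cont_cst.
    by apply: cont_circ; exact: continuous_snd.
- rewrite /q.
  have -> : cint (fun t => rc s * circ t * segment_mean dh (rc (rho u) * circ t) (rc 0 * (rc s * circ t))) =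
     cint (fun t => rc s * (circ t * dh (rc (rho u) * circ t))).
    by apply: eq_cint => t _; rewrite rmorph0 mul0r segment_mean0 mulrA.
  have Au t : A (rc (rho u) * circ t) by apply: Aab; rewrite au.
  rewrite cintZl; last first.
    move=> t t01; apply: contM; first exact: circ_continuous.
    exact: (cont_comp (@cont_circ_scaled _ t) erefl (dc _ (Au t))).
  rewrite (@circ_integral_deriv h) ?mulr0//.
  + by rewrite gt_eqF// (le_lt_trans a0).
  + by move=> t _; exact: hd.
  + by move=> t _; exact: dc.
have rho0 : rho (u + 0) = rho u by rewrite addr0.
have nb : \forall x \near rho u, a < x < b.
  by apply: near_in_itvoo; rewrite in_itv /= au.
have abk := near_preimage rhoc rho0 nb.
near=> k.
have kab : a < rho (u + k) < b by near: k.
have hcc r : a < r < b -> ccont (fun t => h (rc r * circ t)).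
  move=> rab t t01.
  exact: (cont_comp (@cont_circ_scaled _ t) erefl (hc _ (Aab r t rab))).
rewrite /M /q -cintZl; last first.
  move=> t t01; apply: contM.
    by apply: contM; [exact: cont_cst|exact: circ_continuous].
  apply: (cont_comp (f := fun t => (k, t)) _ erefl (cc k t kab)).
  by apply: continuous_pair; [exact: cont_cst|exact: cont_id].
rewrite -cintD.
- apply: eq_cint => t t01.
  have -> : rc (rho (u + k)) * circ t = rc (rho u) * circ t + rc k * (rc s * circ t).
    by rewrite /rho !(rmorphD, rmorphM) /=; ring.
  rewrite (@segment_meanE _ h dh).
  + by ring.
  + by move=> v v01; apply: hd; exact: near_in.
  + by move=> v v01; apply: dc; exact: near_in.
- by apply: hcc; rewrite au.
- move=> t t01; apply: contM; first exact: cont_cst.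
  apply: contM; first by apply: contM; [exact: cont_cst|exact: circ_continuous].
  apply: (cont_comp (f := fun t => (k, t)) _ erefl (cc k t kab)).
  by apply: continuous_pair; [exact: cont_cst|exact: cont_id].
Unshelve. all: by end_near. Qed.

End Circle.

(** * The mean value property and its consequences *)

Section CauchyCoefficients.
Context {R : realType}.
Local Notation C := (cplx R).
Implicit Types (h g : C -> C) (x d : C).

Lemma rc_gt0 (e : R) : (0 < rc e) = (0 < e).
Proof. by rewrite -rc_lt rmorph0. Qed.

Lemma normc_rcP x : exists2 r : R, 0 <= r & `|x| = rc r.
Proof.
exists (Num.sqrt (complex.Re x ^+ 2 + complex.Im x ^+ 2)); first exact: sqrtr_ge0.
exact: normc_def.
Qed.

Lemma near_ballP x (P : C -> Prop) : (\forall y \near x, P y) ->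
  exists2 e : R, 0 < e & forall y, `|x - y| < rc e -> P y.
Proof.
by move=> /nbhs_normP[e /= /gt0_rcP[r r0 ->] H]; exists r.
Qed.

Lemma open_disc (rho : R) : open [set x : C | `|x| < rc rho].
Proof.
rewrite openE => x /= xb; have xb0 : 0 < rc rho - `|x| by rewrite subr_gt0.
apply/nbhs_normP; exists (rc rho - `|x|) => // y /= yx.
rewrite -(subrK x y); apply: le_lt_trans (ler_normD _ _) _.
by rewrite -ltrBrDr distrC.
Qed.

Lemma normc_eq0 x : (forall e : R, 0 < e -> `|x| <= rc e) -> x = 0.
Proof.
move=> H; have [r r0 xr] := normc_rcP x.
apply/eqP; rewrite -normr_eq0 xr; apply/eqP.
have [r1|r1] := ltP 0 r.
  have := H (r / 2) (divr_gt0 r1 (ltr0Sn _ 1)); rewrite xr rc_le => ?; exfalso; lra.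
by have -> : r = 0 by lra; rewrite rmorph0.
Qed.

Lemma rc_circ_norm (r : R) t : 0 <= r -> `|rc r * circ t| = rc r.
Proof. by move=> r0; rewrite normrM normc_circ mulr1 normc_rc ger0_norm. Qed.

Lemma ccont_circ h (r : R) : (forall t, {for rc r * circ t, continuous h}) ->
  ccont (fun t => h (rc r * circ t)).
Proof. by move=> hc t _; exact: (cont_comp (@cont_circ_scaled _ r t) erefl (hc t)). Qed.

(** The mean does not depend on the radius and tends to h 0 as the circle shrinks. At the centre
    only continuity is asked for, so that the lemma covers quotients with a removable
    singularity. *)
Lemma mean_value h dh (A : set C) (b r : R) : open A ->
  (forall s t, 0 < s < b -> A (rc s * circ t)) ->
  (forall x, A x -> cderiv h x (dh x)) ->
  (forall x, A x -> {for x, continuous dh}) ->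
  {for 0, continuous h} -> 0 < r < b ->
  cint (fun t => h (rc r * circ t)) = h 0.
Proof.
move=> oA Aab hd dc /continuousC_distP h0 rb.
apply/eqP; rewrite eq_sym -subr_eq0; apply/eqP; apply: normc_eq0 => e e0.
have e20 : 0 < e / 2 by lra.
have [d d0 hd0] := near_ballP (h0 _ e20).
pose s := Num.min b d / 2.
have b0 : 0 < b by case/andP: rb; apply: lt_trans.
have m0 : 0 < Num.min b d by rewrite lt_min b0.
have s0 : 0 < s by rewrite /s; lra.
have sb : 0 < s < b.
  rewrite s0 /=; have : Num.min b d <= b by rewrite ge_min lexx.
  by rewrite /s; lra.
have sd : s < d.
  have : Num.min b d <= d by rewrite ge_min lexx orbT.
  by rewrite /s; lra.
have hc t : {for rc s * circ t, continuous h}.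
  exact: (cderiv_continuous (hd _ (Aab s t sb))).
rewrite (circ_integral_radius oA (lexx 0) Aab hd dc rb sb).
rewrite -{1}(cint_cst (h 0)) -cintB; [|exact: ccont_cst|exact: ccont_circ].
have -> : e = e / 2 *+ 2 by lra.
apply: cint_bound.
  move=> t t01; apply: contB; first exact: cont_cst.
  exact: (ccont_circ hc).
move=> t _; apply: ltW; apply: hd0.
by rewrite sub0r normrN rc_circ_norm ?rc_lt// ltW.
Qed.

(* g tends to 0 at infinity, hence so do its means over circles, all equal to g 0. *)
Lemma entire_eq0 g dg h (k : nat) :
  (forall x, cderiv g x (dg x)) -> (forall x, {for x, continuous dg}) ->
  {for 0, continuous h} -> (0 < k)%N ->
  (forall x, x != 0 -> g x = h x^-1 * x ^- k) -> g 0 = 0.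
Proof.
move=> gd dc /continuousC_distP h0 k0 E.
have [d d0 hd] := near_ballP (h0 1 ltr01).
have [K K0 hK] := normc_rcP (h 0).
apply: normc_eq0 => e e0.
(* The three summands serve in turn to give r >= 1, hence r ^ k >= r; 1 / r < d, hence |h(1/x)| <= K
   + 1 on the circle; and 2 (K + 1) / r <= e, the factor 2 coming from [cint_bound]. *)
pose r := 1 + d^-1 + (K + 1) *+ 2 / e.
have dV0 : 0 < d^-1 by rewrite invr_gt0.
have q0 : 0 < (K + 1) *+ 2 / e by rewrite divr_gt0//; lra.
have r1 : 1 <= r by rewrite /r; lra.
have r0 : 0 < r by lra.
have rd : r^-1 < d by rewrite invf_plt ?posrE// /r; lra.
have er : (K + 1) / r *+ 2 <= e.
    rewrite -mulrnAl ler_pdivrMr// -ler_pdivrMl// mulrC; rewrite /r; lra.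
clearbody r.
have rc0 t : rc r * circ t != 0 by rewrite rc_circ_neq0// gt_eqF.
have gc t : {for rc r * circ t, continuous g} by exact: (cderiv_continuous (gd _)).
rewrite -(@mean_value g dg setT (r + 1) r openT).
- apply: (@le_trans _ _ (rc ((K + 1) / r *+ 2))); last by rewrite rc_le.
  apply: cint_bound; first exact: ccont_circ.
  move=> t _; rewrite E// normrM normfV normrX rc_circ_norm; last exact: ltW.
  rewrite rmorphM fmorphV; apply: ler_pM => //.
  + by rewrite invr_ge0 exprn_ge0// -(rmorph0 rc) rc_le ltW.
  + rewrite -(subrK (h 0) (h _)); apply: le_trans (ler_normD _ _) _.
    rewrite hK rmorphD rmorph1 [leRHS]addrC lerD2r distrC -(rmorph1 rc).
    apply: ltW; apply: hd; rewrite sub0r normrN normfV rc_circ_norm; last exact: ltW.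
    by rewrite -fmorphV rc_lt.
  + rewrite -rmorphXn -!fmorphV rc_le lef_pV2 ?posrE ?exprn_gt0//.
    by rewrite -{1}(expr1 r); exact: ler_weXn2l.
- by [].
- by move=> x _; exact: gd.
- by move=> x _; exact: dc.
- exact: (cderiv_continuous (gd 0)).
- by apply/andP; split; lra.
Qed.

Lemma cderiv_near_eq h g x d : (\forall y \near x, h y = g y) -> cderiv h x d -> cderiv g x d.
Proof.
move=> hg [q [qc q0 qE]]; exists q; split; [exact: qc|exact: q0|].
have hgx := nbhs_singleton hg.
have c : {for 0, continuous (fun k : C => x + k)} by apply: contD; [exact: cont_cst|exact: cont_id].
have hg' := near_preimage c (addr0 x) hg.
by near=> k; rewrite -hgx -(near hg' k)//; near: k.
Unshelve. all: by end_near. Qed.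

Lemma continuous_near_eq (T : topologicalType) (f1 f2 : T -> C) (x : T) :
  (\forall y \near x, f1 y = f2 y) -> {for x, continuous f1} -> {for x, continuous f2}.
Proof.
move=> E /continuousC_distP c; apply/continuousC_distP => e /c.
by rewrite (nbhs_singleton E); apply: filterS2 E => y ->.
Qed.

(** Integrating in t means integrating against dx / (2 pi i x), and x times the derivative of
    x^-(k+1) is -(k+1) x^-(k+1). Up to a constant, the power is therefore its own primitive for this
    measure. *)
Lemma circ_monomial (r : R) k : 0 < r -> cint (fun t => ((rc r * circ t) ^+ k.+1)^-1) = 0.
Proof.
move=> r0; have rn t := @rc_circ_neq0 R r t (lt0r_neq0 r0).
have r00 : rc r != 0 by rewrite gt_eqF// rc_gt0.
have cx t : {for rc r * circ t, continuous (fun x : C => x ^+ k.+1)} by apply: contX; exact: cont_id.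
have := @circ_integral_deriv R (fun x => (x ^+ k.+1)^-1)
  (fun x => - (k.+1%:R * x ^+ k) / (x ^+ k.+1) ^+ 2) r (lt0r_neq0 r0).
have -> : cint (fun t => circ t * (- (k.+1%:R * (rc r * circ t) ^+ k) / ((rc r * circ t) ^+ k.+1) ^+ 2)) =
   cint (fun t => (- (k.+1%:R / rc r)) * ((rc r * circ t) ^+ k.+1)^-1).
  apply: eq_cint => t _; rewrite !exprS; field.
  by rewrite ?r00 ?circ_neq0 ?expf_neq0 ?mulf_neq0 ?r00 ?circ_neq0.
rewrite cintZl => [H|].
  have /eqP : - (k.+1%:R / rc r) * cint (fun t => ((rc r * circ t) ^+ k.+1)^-1) = 0.
    apply: H => t _.
      apply: cderivV; first by rewrite expf_neq0.
      exact: cderivX.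
    apply: contM.
      by apply: contN; apply: contM; [exact: cont_cst|apply: contX; exact: cont_id].
    by apply: contV; [rewrite !expf_neq0|apply: contX; exact: cx].
  by rewrite mulf_eq0 oppr_eq0 mulf_eq0 invr_eq0 (negPf r00) pnatr_eq0 /= => /eqP.
move=> t _; apply: (cont_comp (g := fun x : C => (x ^+ k.+1)^-1) (@cont_circ_scaled _ r t) erefl).
by apply: contV; [rewrite expf_neq0|exact: cx].
Qed.

End CauchyCoefficients.

(** * Taylor coefficients as means over circles *)

Section TaylorCoefficients.
Context {R : realType}.
Local Notation C := (cplx R).
Implicit Types (h g : C -> C) (x d : C).

Lemma sum_half_le (K : numFieldType) L : \sum_(l < L) (2^-1 : K) ^+ l <= 2.
Proof.
have -> : \sum_(l < L) (2^-1 : K) ^+ l = 2 - 2 * 2^-1 ^+ L.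
  elim: L => [|L IHL]; first by rewrite big_ord0 expr0 mulr1 subrr.
  by rewrite big_ord_recr /= IHL exprS; field.
by rewrite gerBl mulr_ge0// exprn_ge0// invr_ge0.
Qed.

(** On |x| <= rho / 2 the terms are dominated by a geometric series of ratio 1/2. The bound is
    uniform in the length [L] and is |x|^i times a multiple of |x|, so it still tends to 0 after
    division by x^i. *)
Lemma series_tail_bound (c : nat -> C) (B rho x : C) i L : 0 < rho -> 0 <= B ->
  (forall j, `|c j| * rho ^+ j <= B) -> `|x| <= rho / 2 ->
  `|\sum_(l < L) c (i.+1 + l)%N * x ^+ (i.+1 + l)| <= `|x| ^+ i * (B * rho ^- i.+1 * 2 * `|x|).
Proof.
move=> r0 B0 cB xr.
have -> : `|x| ^+ i * (B * rho ^- i.+1 * 2 * `|x|) = (B * rho ^- i.+1 * `|x| ^+ i.+1) * 2.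
  by rewrite [`|x| ^+ i.+1]exprS; ring.
apply: le_trans (ler_norm_sum _ _ _) _.
have P0 : 0 <= B * rho ^- i.+1 * `|x| ^+ i.+1.
  by rewrite !mulr_ge0 ?exprn_ge0// invr_ge0 exprn_ge0// ltW.
apply: le_trans (ler_wpM2l P0 (sum_half_le C L)).
rewrite mulr_sumr; apply: ler_sum => l _.
rewrite normrM normrX exprD.
have cj : `|c (i.+1 + l)%N| <= B * rho ^- i.+1 * rho ^- l.
  rewrite -mulrA -invfM -exprD -ler_pdivrMr ?invr_gt0 ?exprn_gt0// invrK.
  exact: cB.
apply: le_trans (ler_wpM2r _ cj) _; first by rewrite mulr_ge0// exprn_ge0.
rewrite mulrACA [rho ^- l * _]mulrC.
apply: ler_wpM2l => //; rewrite -expr_div_n lerXn2r ?nnegrE//.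
- by rewrite divr_ge0// ltW.
- by rewrite ler_pdivrMr// mulrC.
Qed.

(** Abel's argument: convergence at a single point rho > 0 bounds the numbers |c_j| rho^j, which
    controls all tails on |x| <= rho / 2. Thus pointwise convergence suffices. *)
Lemma taylor_remainder_continuous (c : nat -> C) g i :
  (\forall x \near (0 : C), series (fun j => c j * x ^+ j) @ \oo --> g x) ->
  {for 0, continuous (fun x => if x == 0 then c i
     else x ^- i * (g x - \sum_(j < i) c j * x ^+ j))}.
Proof.
move=> /near_ballP[d d0 gd].
pose rho : C := rc (d / 2).
have rho0 : 0 < rho by rewrite rc_gt0; lra.
have cvr : series (fun j => c j * rho ^+ j) @ \oo --> g rho.
  by apply: gd; rewrite sub0r normrN normc_rc rc_lt ger0_norm; lra.
(* The terms tend to 0, so they are below 1 from some index [N] on; the finite sum in the witness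
   takes care of the earlier ones. *)
have [B B0 cB] : exists2 B : C, 0 <= B & forall j, `|c j| * rho ^+ j <= B.
  have : cvgn (series (fun j => c j * rho ^+ j)) by apply/cvg_ex; exists (g rho).
  move=> /cvg_series_cvg_0 t0.
  have /(@cvgrPdist_lt C C^o nat \oo _)/(_ 1 ltr01) := t0.
  move=> [N _ HN].
  exists (\sum_(j < N) `|c j| * rho ^+ j + 1).
    by rewrite addr_ge0// sumr_ge0// => j _; rewrite mulr_ge0// exprn_ge0// ltW.
  move=> j; have [jN|Nj] := ltnP j N.
    rewrite (bigD1 (Ordinal jN))//= -addrA lerDl addr_ge0// sumr_ge0// => l _.
    by rewrite mulr_ge0// exprn_ge0// ltW.
  have := HN j Nj; rewrite /= sub0r normrN normrM normrX [`|rho|]gtr0_norm// => /ltW h.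
  apply: le_trans h _; rewrite lerDr sumr_ge0// => l _.
  by rewrite mulr_ge0// exprn_ge0// ltW.
apply/continuousC_distP => e e0; rewrite eqxx.
pose M := B * rho ^- i.+1 * 2.
have Mc : {for 0, continuous (fun x : C => M * x)} by apply: contM; [exact: cont_cst|exact: cont_id].
have e20 : 0 < e / 2 by lra.
have /continuousC_distP/(_ _ e20) := Mc; rewrite mulr0 => Mx.
have ball0 : \forall x \near (0 : C), `|x| < rho / 2.
  have r20 : 0 < rho / 2 by rewrite divr_gt0.
  by apply/nbhs_normP; exists (rho / 2) => // y /=; rewrite sub0r normrN.
near=> x.
have xr : `|x| < rho / 2 by near: x.
have Mxe : `|0 - M * x| < rc (e / 2) by near: x.
case: eqVneq => [_|x0]; first by rewrite subrr normr0 rc_gt0.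
have xi0 : 0 < `|x ^+ i| by rewrite normr_gt0 expf_neq0.
have gx : series (fun j => c j * x ^+ j) @ \oo --> g x.
  apply: gd; rewrite sub0r normrN; apply: lt_trans xr _.
  rewrite /rho -(rmorph_nat rc 2) -fmorphV -rmorphM rc_lt; lra.
have /(@cvgrPdist_lt C C^o nat \oo _) := gx.
(* A partial sum is taken that contains the term of index i and is within |x|^i e / 2 of g x. Its
   length depends on x, which is harmless because the tail bound is uniform in the length. *)
have xe0 : 0 < `|x ^+ i| * rc (e / 2) by apply: mulr_gt0 xi0 _; rewrite rc_gt0.
move=> /(_ _ xe0) [N _ HN].
have := HN (i.+1 + N)%N (leq_addl _ _) => /=.
rewrite /series /= big_mkord big_split_ord /= big_ord_recr /=.
set T := \sum_(_ < N) _; set S := \sum_(_ < i) _ => H.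
have TB : `|T| <= `|x| ^+ i * (M * `|x|) := series_tail_bound i N rho0 B0 cB (ltW xr).
have -> : c i - x ^- i * (g x - S) =
    - (x ^- i * ((g x - (S + c i * x ^+ i + T)) + T)).
  by field; rewrite expf_neq0.
rewrite normrN normrM normfV mulrC ltr_pdivrMr//.
apply: le_lt_trans (ler_normD _ _) _.
have -> : rc e * `|x ^+ i| = `|x ^+ i| * rc (e / 2) + `|x ^+ i| * rc (e / 2).
  rewrite -mulrDr -rmorphD mulrC; congr (_ * rc _); lra.
apply: ltr_leD => //; apply: le_trans TB _; rewrite -normrX ler_wpM2l//.
have M0 : 0 <= M by rewrite !mulr_ge0// invr_ge0 exprn_ge0// ltW.
by move: Mxe; rewrite sub0r normrN normrM (ger0_norm M0) => /ltW.
Unshelve. all: by end_near. Qed.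

(* Cauchy's formula: the mean over the circle of x^-i (g x - sum_(j < i) c_j x^j)
   is its limit c_i at 0, and the subtracted powers have mean 0. *)
Lemma taylor_coef_circle (c : nat -> C) g dg (b r : R) i :
  (forall x, `|x| < rc b -> cderiv g x (dg x)) ->
  (forall x, `|x| < rc b -> {for x, continuous dg}) ->
  (\forall x \near (0 : C), series (fun j => c j * x ^+ j) @ \oo --> g x) ->
  0 < r < b ->
  c i = cint (fun t => g (rc r * circ t) * (rc r * circ t) ^- i).
Proof.
move=> gd dc tay rb; have [r0 rb'] := andP rb.
pose P x := \sum_(j < i) (- c j) * x ^+ j.
(* The derivatives [dP], [dQ] and [dk] keep the unsimplified shape in which the product and quotient
   rules deliver them. *)
pose dP x := \sum_(j < i) (0 * x ^+ j + (- c j) * (j%:R * x ^+ j.-1)).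
pose Q x := (x ^+ i)^-1; pose dQ x := - (i%:R * x ^+ i.-1) / (x ^+ i) ^+ 2.
pose h x := if x == 0 then c i else x ^- i * (g x - \sum_(j < i) c j * x ^+ j).
pose k x := Q x * (g x + P x).
pose dk x := dQ x * (g x + P x) + Q x * (dg x + dP x).
pose A := [set x : C | x != 0] `&` [set x | `|x| < rc b].
have idc (x : C) : {for x, continuous (fun y : C => y)} by exact: cont_id.
have oA : open A.
  apply: openI.
    by rewrite openE => x /= x0; exact: (cont_neq0 (idc x) x0).
  exact: open_disc.
have hk x : x != 0 -> h x = k x.
  move=> /negPf x0; rewrite /h /k x0 /Q /P; congr (_ * (_ + _)).
  by rewrite -sumrN; apply: eq_bigr => j _; rewrite mulNr.
have dPx x : cderiv P x (dP x).
  apply: (@cderiv_sum _ i (fun j x => - c j * x ^+ j)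
     (fun j x => 0 * x ^+ j + (- c j) * (j%:R * x ^+ j.-1))) => j.
  by apply: cderivM; [exact: cderiv_cst|exact: cderivX].
have dQx x : x != 0 -> cderiv Q x (dQ x).
  by move=> x0; apply: cderivV; [rewrite expf_neq0|exact: cderivX].
have hd x : A x -> cderiv h x (dk x).
  move=> [/= x0 xb].
  apply: (@cderiv_near_eq _ k).
    apply: (filterS _ (cont_neq0 (idc x) x0)) => y y0; exact/esym/hk.
  apply: cderivM; first exact: dQx.
  by apply: cderivD; [exact: gd|exact: dPx].
have cX n x : {for x, continuous (fun y : C => y ^+ n)} by apply: contX; exact: cont_id.
have Pc x : {for x, continuous P} by exact: (cderiv_continuous (dPx x)).
have dkc x : A x -> {for x, continuous dk}.
  move=> [/= x0 xb]; have gc := cderiv_continuous (gd _ xb).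
  have cQ : {for x, continuous Q} by apply: contV; [rewrite expf_neq0|exact: cX].
  have cdQ : {for x, continuous dQ}.
    apply: contM; first by apply: contN; apply: contM; [exact: cont_cst|exact: cX].
    by apply: contV; [rewrite !expf_neq0|apply: contX; exact: cX].
  have cdP : {for x, continuous dP}.
    apply: cont_sum => j; apply: contD; first by apply: contM; [exact: cont_cst|exact: cX].
    by apply: contM; [exact: cont_cst|apply: contM; [exact: cont_cst|exact: cX]].
  exact: (contD (contM cdQ (contD gc (Pc x))) (contM cQ (contD (dc x xb) cdP))).
have Ab s t : 0 < s < b -> A (rc s * circ t).
  move=> /andP[s0 sb]; split=> /=; first by rewrite rc_circ_neq0// gt_eqF.
  by rewrite rc_circ_norm ?rc_lt// ltW.
have := mean_value oA Ab hd dkc (@taylor_remainder_continuous c g i tay) rb.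
rewrite /h eqxx => <-.
have rn t : rc r * circ t != 0 by rewrite rc_circ_neq0// gt_eqF.
have cQ n : ccont (fun t => ((rc r * circ t) ^+ n)^-1).
  apply: (@ccont_circ _ (fun x => (x ^+ n)^-1)) => t.
  by apply: contV; [rewrite expf_neq0|exact: cX].
have cg : ccont (fun t => g (rc r * circ t) * (rc r * circ t) ^- i).
  apply: ccontM; last exact: cQ.
  apply: ccont_circ => t; apply: cderiv_continuous (gd _ _).
  by rewrite rc_circ_norm ?rc_lt// ltW.
(* Writing the exponent i - j as (i - j.+1).+1 makes visible that it is positive for j < i, which is
   what [circ_monomial] needs. *)
have -> : cint (fun t => if rc r * circ t == 0 then c i else (rc r * circ t) ^- i *
    (g (rc r * circ t) - \sum_(j < i) c j * (rc r * circ t) ^+ j)) =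
  cint (fun t => g (rc r * circ t) * (rc r * circ t) ^- i +
    \sum_(j < i) (- c j) * ((rc r * circ t) ^+ (i - j.+1).+1)^-1).
  apply: eq_cint => t _; rewrite (negPf (rn t)) mulrBr [_ * g _]mulrC; congr (_ + _).
  rewrite mulr_sumr -sumrN; apply: eq_bigr => j _.
  rewrite subnSK// mulNr; congr (- _); rewrite mulrCA; congr (_ * _).
  have {1}-> : i = (j + (i - j))%N by rewrite subnKC// ltnW.
  by rewrite exprD invfM mulrAC mulVf ?mul1r// expf_neq0.
rewrite cintD; [|exact: cg|]; last first.
  by apply: ccont_sum => j; apply: ccontM; [exact: ccont_cst|exact: cQ].
rewrite cint_sum; last by move=> j; apply: ccontM; [exact: ccont_cst|exact: cQ].
rewrite big1 ?addr0// => j _.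
rewrite cintZl; last exact: cQ.
by rewrite circ_monomial// mulr0.
Qed.

End TaylorCoefficients.

(** * Holomorphy in several variables *)

Section QuotientDifferentiable.
Context {R : realType} {d : nat}.
Local Notation C := (cplx R).
Implicit Types (F : 'rV[C]_d -> C) (p : 'rV[C]_d).

Definition lincomb (c : 'I_d -> C) (v : 'rV[C]_d) : C := \sum_j v 0 j * c j.

Lemma lincomb_is_linear c : linear (lincomb c : 'rV[C]_d -> C).
Proof.
move=> a u v; rewrite /lincomb scaler_sumr -big_split /=; apply: eq_bigr => j _.
by rewrite !mxE mulrDl -mulrA.
Qed.

HB.instance Definition _ c :=
  GRing.isLinear.Build C 'rV[C]_d C *:%R (lincomb c) (lincomb_is_linear c).

Lemma cont_coord j p : {for p, continuous (fun v : 'rV[C]_d => v 0 j)}.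
Proof. exact: coord_continuous. Qed.

Lemma normc_coord_le (v : 'rV[C]_d) j : `|v 0 j| <= `|v|.
Proof.
rewrite [leRHS]/Num.norm /= mx_normE.
exact: (le_bigmax (0%:nng : {nonneg C}) (fun i : 'I_1 * 'I_d => `|v i.1 i.2|%:nng) (0, j)).
Qed.

Lemma lincomb_continuous c : continuous (lincomb c).
Proof.
have lc (p : 'rV[C]_d) : {for p, continuous (fun v : 'rV[C]_d => \sum_j v 0 j * c j)}.
  apply: cont_sum => j.
  by apply: contM; [exact: cont_coord|exact: cont_cst].
exact: lc.
Qed.

(** Subtracting the linear form with coefficients q_j(p) leaves a sum of terms (b_j - p_j)(q_j(b) -
    q_j(p)), which is o(|b - p|) by continuity of the q_j at p. Hadamard's formula supplies such q_j
    for Cauchy integrals. *)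
Lemma differentiable_quotient F p (q : 'I_d -> 'rV[C]_d -> C) :
  (forall j, {for p, continuous (q j)}) ->
  (\forall b \near p, F b = F p + \sum_j (b 0 j - p 0 j) * q j b) ->
  differentiable F p /\ forall j, 'D_(delta_mx 0 j) F p = q j p.
Proof.
move=> qc FE.
have sh : {for (0 : 'rV[C]_d), continuous (fun h : 'rV[C]_d => h + p)}.
  by apply: continuousD; [exact: cont_id|exact: cont_cst].
have E : F \o shift p = cst (F p) + lincomb (q^~ p) +o_ (0 : 'rV[C]_d) id.
  apply/eqaddoP => e e0.
  have [e' e'0 ee'] := gt0_rcP e0.
  (* There are d error terms, each at most s |h|; dividing by d + 1 also covers d = 0. *)
  pose s := e' / d.+1%:R.
  have s0 : 0 < s by rewrite divr_gt0.
  have qn j : \forall h \near (0 : 'rV[C]_d), `|q j p - q j (h + p)| < rc s.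
    have /continuousC_distP/(_ _ s0) := qc j.
    exact: (near_preimage sh (add0r p)).
  have qn' : \forall h \near (0 : 'rV[C]_d), forall j, `|q j p - q j (h + p)| < rc s.
    exact: (@filter_forall _ _ (fun j h => `|q j p - q j (h + p)| < rc s) _ (nbhs_filter (0 : 'rV[C]_d)) qn).
  have FE' := near_preimage sh (add0r p) FE.
  near=> h.
  have Fh : F (h + p) = F p + \sum_j ((h + p) 0 j - p 0 j) * q j (h + p) by near: h.
  have qh : forall j, `|q j p - q j (h + p)| < rc s by near: h.
  rewrite !fctE /= Fh.
  have -> : F p + \sum_j ((h + p) 0 j - p 0 j) * q j (h + p) - (F p + lincomb (q^~ p) h) =
     \sum_j h 0 j * (q j (h + p) - q j p).
    rewrite opprD addrACA subrr add0r /lincomb -sumrB; apply: eq_bigr => j _.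
    by rewrite mxE addrK mulrBr.
  apply: le_trans (ler_norm_sum _ _ _) _.
  apply: (@le_trans _ _ (\sum_(j < d) rc s * `|h|)).
    apply: ler_sum => j _; rewrite normrM mulrC; apply: ler_pM => //.
      by rewrite distrC ltW.
    exact: normc_coord_le.
  rewrite sumr_const card_ord -mulrnAl; apply: ler_wpM2r => //.
  rewrite ee' -rmorphMn rc_le /s -mulr_natr mulrAC ler_pdivrMr//.
  by rewrite ler_wpM2l ?ler_nat// ltW.
have dE := diff_unique (@lincomb_continuous (q^~ p)) E.
have dF : differentiable F p.
  by apply/diff_locallyP; rewrite dE; split; [exact: lincomb_continuous|].
split=> [//|j]; rewrite deriveE// dE /= /lincomb (bigD1 j)//= big1 => [|i ij].
  by rewrite mxE !eqxx mul1r addr0.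
by rewrite mxE (negPf ij) andbF mul0r.
Unshelve. all: by end_near. Qed.

End QuotientDifferentiable.

(** * Functions of (x, y) that are holomorphic in y *)

Section Polydisc.
Context {R : realType}.
Local Notation C := (cplx R).
Context (rho : R).

Lemma near_disc (T : topologicalType) (f : T -> C) x :
  {for x, continuous f} -> `|f x| < rc rho -> \forall y \near x, `|f y| < rc rho.
Proof.
move=> fc fx; have nb : \forall z \near f x, `|z| < rc rho.
  by apply: open_nbhs_nbhs; split; [exact: open_disc|exact: fx].
exact: (near_preimage fc erefl nb).
Qed.

Lemma disc_convex (x y : C) (t : R) : `|x| < rc rho -> `|y| < rc rho -> 0 <= t <= 1 ->
  `|x + rc t * (y - x)| < rc rho.
Proof.
move=> xb yb t01.
have [r1 r10 e1] := normc_rcP x; have [r2 r20 e2] := normc_rcP y.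
rewrite e1 rc_lt in xb; rewrite e2 rc_lt in yb.
(* The bound -1 only provides a strict lower end for the norms, as the open interval of
   [itvoo_convex] requires. *)
have h1 : -1 < r1 < rho by rewrite xb andbT; lra.
have h2 : -1 < r2 < rho by rewrite yb andbT; lra.
have /andP[_ h] := itvoo_convex h1 h2 t01.
apply: le_lt_trans (_ : rc ((1 - t) * r1 + t * r2) < rc rho); last by rewrite rc_lt.
have -> : x + rc t * (y - x) = rc (1 - t) * x + rc t * y.
  by rewrite rmorphB rmorph1; ring.
apply: le_trans (ler_normD _ _) _; rewrite !normrM e1 e2 !normc_rc -!rmorphM -rmorphD.
by rewrite rc_le !ger0_norm//; lra.
Qed.

Definition polydisc : set (C * C) := [set z | `|z.1| < rc rho /\ `|z.2| < rc rho].

Lemma open_polydisc : open polydisc.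
Proof.
have o1 : open ((fst : C * C -> C) @^-1` [set x | `|x| < rc rho]).
  by apply: open_comp; [move=> z _; exact: continuous_fst|exact: open_disc].
have o2 : open ((snd : C * C -> C) @^-1` [set x | `|x| < rc rho]).
  by apply: open_comp; [move=> z _; exact: continuous_snd|exact: open_disc].
exact: openI o1 o2.
Qed.

(** The coordinates a enter the integrals over the circle only through y = s_a(x), so
    differentiating in a calls for the derivative in y together with joint continuity in (x, y). The
    class is stable under taking primitives in y. *)
Definition holomorphic_in_y (phi dphi : C -> C -> C) :=
  [/\ forall z, polydisc z -> cderiv (phi z.1) z.2 (dphi z.1 z.2),
      forall z, polydisc z -> {for z, continuous (fun z : C * C => phi z.1 z.2)} &
      forall z, polydisc z -> {for z, continuous (fun z : C * C => dphi z.1 z.2)}].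

Context (phi dphi : C -> C -> C) (hol : holomorphic_in_y phi dphi).

Lemma segment_polydisc x y l : polydisc (x, y) -> `|y + l| < rc rho ->
  forall t, 0 <= t <= 1 -> polydisc (x, y + rc t * l).
Proof.
move=> [/= xr yr] yl t t01; split=> //=.
have -> : y + rc t * l = y + rc t * (y + l - y) by rewrite [y + l]addrC addrK.
exact: disc_convex.
Qed.

Lemma cont_curry (f : C -> C -> C) x y : {for (x, y), continuous (fun z : C * C => f z.1 z.2)} ->
  {for y, continuous (f x)}.
Proof.
move=> fc; apply: (cont_comp (f := fun y : C => (x, y)) (g := fun z : C * C => f z.1 z.2) _ erefl fc).
by apply: continuous_pair; [exact: cont_cst|exact: cont_id].
Qed.

Lemma segment_mean_yE x y l : polydisc (x, y) -> `|y + l| < rc rho ->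
  phi x (y + l) = phi x y + l * segment_mean (dphi x) y l.
Proof.
move=> xy yl; have sg := segment_polydisc xy yl; have [h1 _ h3] := hol.
apply: segment_meanE => t t01; first exact: (h1 _ (sg t t01)).
exact: (cont_curry (h3 _ (sg t t01))).
Qed.

Lemma segment_mean_y_continuous x y l : polydisc (x, y) -> `|y + l| < rc rho ->
  {for (x, y, l), continuous (fun z : C * C * C => segment_mean (dphi z.1.1) z.1.2 z.2)}.
Proof.
move=> xy yl; have [_ _ h3] := hol.
apply: (segment_mean_continuous open_polydisc h3).
exact: segment_polydisc.
Qed.

End Polydisc.

(** * Coefficients of phi(x, s_a(x)) as holomorphic functions of a *)

Section SectionCoefficients.
Context {R : realType} {m : nat}.
Local Notation C := (cplx R).
Local Notation V := 'rV[C]_m.+1.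
Context (rho r : R) (rho1 : rho <= 1) (r_rho : 0 < r < rho).

(** For |x| < rho <= 1 the powers of x have norm at most 1, so this l^1 ball keeps the graph of s_a
    over the disc inside the polydisc. *)
Definition tube : set V := [set a | \sum_i `|a 0 i| < rc rho].

Lemma cont_norm (T : topologicalType) (f : T -> C) x :
  {for x, continuous f} -> {for x, continuous (fun y => `|f y|)}.
Proof. by move=> fc; apply: cvg_norm; exact: fc. Qed.

Lemma open_tube : open tube.
Proof.
have nc (a : V) : {for a, continuous (fun a : V => \sum_i `|a 0 i|)}.
  by apply: cont_sum => i; apply: cont_norm; exact: cont_coord.
rewrite (_ : tube = (fun a : V => \sum_i `|a 0 i|) @^-1` [set x | `|x| < rc rho]).
  by apply: open_comp; [move=> a _; exact: nc|exact: open_disc].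
by apply/seteqP; split=> a /=; rewrite ger0_norm// sumr_ge0.
Qed.

Lemma rho_gt0 : 0 < rho. Proof. by case/andP: r_rho; apply: lt_trans. Qed.

Lemma tube0 : tube 0.
Proof. by rewrite /tube /= big1 ?rc_gt0 ?rho_gt0// => i _; rewrite mxE normr0. Qed.

Lemma section_disc (a : V) x : tube a -> `|x| < rc rho -> `|normal_section a x| < rc rho.
Proof.
move=> ta xr; apply: le_lt_trans ta; apply: le_trans (ler_norm_sum _ _ _) _.
apply: ler_sum => i _; rewrite normrM normrX ler_piMr//.
rewrite exprn_ile1//; apply: ltW; apply: lt_le_trans xr _.
by rewrite -(rmorph1 rc) rc_le.
Qed.

Lemma section_continuous (T : topologicalType) (f : T -> V) (g : T -> C) x :
  {for x, continuous f} -> {for x, continuous g} ->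
  {for x, continuous (fun y => normal_section (f y) (g y))}.
Proof.
move=> fc gc; apply: cont_sum => i; apply: contM; last exact: contX.
by apply: (cont_comp (g := fun v : V => v 0 i) fc erefl); exact: cont_coord.
Qed.

Local Notation X t := (rc r * circ t).

Lemma X_disc t : `|X t| < rc rho.
Proof. by case/andP: r_rho => r0 rr; rewrite rc_circ_norm ?rc_lt// ltW. Qed.

Lemma X_neq0 t : X t != 0.
Proof. by case/andP: r_rho => r0 _; rewrite rc_circ_neq0// gt_eqF. Qed.

Lemma cont_X (T : topologicalType) (f : T -> R) x : {for x, continuous f} ->
  {for x, continuous (fun y => X (f y))}.
Proof. by move=> fc; apply: contM; [exact: cont_cst|exact: cont_circ]. Qed.

Lemma cont_X_inv_pow (T : topologicalType) (f : T -> R) x i : {for x, continuous f} ->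
  {for x, continuous (fun y => (X (f y)) ^- i)}.
Proof.
by move=> fc; apply: contV; [rewrite expf_neq0 ?X_neq0|apply: contX; exact: cont_X].
Qed.

Context (phi dphi : C -> C -> C) (hol : holomorphic_in_y rho phi dphi).

(** Cauchy's integral for the coefficient of x^i in phi(x, s_a(x)). The exponent is i and not i + 1
    because dt already contains dx / x. In [circle_coef_partial] the factor X^j is the derivative of
    s_a(X) in a_j. *)
Definition circle_coef i (a : V) : C := cint (fun t => phi (X t) (normal_section a (X t)) * (X t) ^- i).
Definition circle_coef_partial i (j : nat) (a : V) : C :=
  cint (fun t => (X t ^+ j * (X t) ^- i) * dphi (X t) (normal_section a (X t))).

Lemma tube_polydisc a t : tube a -> polydisc rho (X t, normal_section a (X t)).
Proof. by move=> ta; split=> /=; [exact: X_disc|apply: section_disc => //; exact: X_disc]. Qed.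

Lemma Xsection_continuous (T : topologicalType) (f : T -> V) (g : T -> R) x :
  {for x, continuous f} -> {for x, continuous g} ->
  {for x, continuous (fun y => normal_section (f y) (X (g y)))}.
Proof. by move=> fc gc; apply: section_continuous; [exact: fc|exact: cont_X]. Qed.

(** Since s_b - s_a is the sum of the (b_j - a_j) x^j, multiplying Hadamard's quotient in y between
    s_a(X) and s_b(X) by X^(j-i) gives the coefficient of b_j - a_j in the increment of the
    integrand. The resulting identity is exact on the whole tube. *)
Let Q i j (a b : V) (t : R) := (X t ^+ j * (X t) ^- i) *
  segment_mean (dphi (X t)) (normal_section a (X t)) (normal_section b (X t) - normal_section a (X t)).

Lemma open_tube_fst : open ((fst : V * R -> V) @^-1` tube).
Proof. by apply: open_comp; [move=> z _; exact: continuous_fst|exact: open_tube]. Qed.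

Lemma circle_coef_quotient_continuous i j (a b : V) t : tube a -> tube b ->
  {for (b, t), continuous (fun z : V * R => Q i j a z.1 z.2)}.
Proof.
move=> ta tb; have c1 := @continuous_fst V R (b, t); have c2 := @continuous_snd V R (b, t).
apply: contM.
  by apply: contM; [apply: contX; exact: cont_X|exact: cont_X_inv_pow].
have ca : {for (b, t), continuous (fun z : V * R => normal_section a (X z.2))}.
  by apply: Xsection_continuous; [exact: cont_cst|exact: c2].
have cb : {for (b, t), continuous (fun z : V * R => normal_section z.1 (X z.2))}.
  by apply: Xsection_continuous; [exact: c1|exact: c2].
have cp : {for (b, t), continuous (fun z : V * R =>
    (X z.2, normal_section a (X z.2), normal_section z.1 (X z.2) - normal_section a (X z.2)))}.
  apply: continuous_pair; last exact: (contB cb ca).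
  by apply: continuous_pair; [exact: cont_X|exact: ca].
apply: (cont_comp (g := fun z : C * C * C => segment_mean (dphi z.1.1) z.1.2 z.2) cp erefl).
apply: (segment_mean_y_continuous hol); first exact: tube_polydisc.
rewrite addrCA subrr addr0; apply: section_disc => //; exact: X_disc.
Qed.

Lemma ccont_curry (K : V -> R -> C) b : (forall t, {for (b, t), continuous (fun z : V * R => K z.1 z.2)}) ->
  ccont (K b).
Proof.
move=> Kc t _; apply: (cont_comp (f := fun t : R => (b, t)) (g := fun z : V * R => K z.1 z.2) _ erefl (Kc t)).
by apply: continuous_pair; [exact: cont_cst|exact: cont_id].
Qed.

Lemma circle_coef_integrand_continuous i b t : tube b ->
  {for (b, t), continuous (fun z : V * R => phi (X z.2) (normal_section z.1 (X z.2)) * (X z.2) ^- i)}.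
Proof.
move=> tb; have c1 := @continuous_fst V R (b, t); have c2 := @continuous_snd V R (b, t).
apply: contM; last exact: cont_X_inv_pow.
have cp : {for (b, t), continuous (fun z : V * R => (X z.2, normal_section z.1 (X z.2)))}.
  by apply: continuous_pair; [exact: cont_X|apply: Xsection_continuous; [exact: c1|exact: c2]].
have [_ h2 _] := hol.
exact: (cont_comp (g := fun z : C * C => phi z.1 z.2) cp erefl (h2 _ (tube_polydisc t tb))).
Qed.

Lemma circle_coef_partial_integrand_continuous i j b t : tube b ->
  {for (b, t), continuous (fun z : V * R => (X z.2 ^+ j * (X z.2) ^- i) *
     dphi (X z.2) (normal_section z.1 (X z.2)))}.
Proof.
move=> tb; have c1 := @continuous_fst V R (b, t); have c2 := @continuous_snd V R (b, t).
apply: contM; first by apply: contM; [apply: contX; exact: cont_X|exact: cont_X_inv_pow].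
have cp : {for (b, t), continuous (fun z : V * R => (X z.2, normal_section z.1 (X z.2)))}.
  by apply: continuous_pair; [exact: cont_X|apply: Xsection_continuous; [exact: c1|exact: c2]].
have [_ _ h3] := hol.
exact: (cont_comp (g := fun z : C * C => dphi z.1 z.2) cp erefl (h3 _ (tube_polydisc t tb))).
Qed.

Lemma circle_coef_partial_continuous i j a : tube a -> {for a, continuous (circle_coef_partial i j)}.
Proof.
move=> ta; apply: (@cint_continuous _ V _ (fun a t => (X t ^+ j * (X t) ^- i) *
     dphi (X t) (normal_section a (X t))) a open_tube_fst).
  by move=> t _ /=.
by move=> [b t] /= tb; exact: circle_coef_partial_integrand_continuous.
Qed.

Lemma circle_coef_quotient i a b : tube a -> tube b ->
  circle_coef i b = circle_coef i a + \sum_j (b 0 j - a 0 j) * cint (Q i j a b).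
Proof.
move=> ta tb.
have cQ (j : 'I_m.+1) : ccont (Q i j a b).
  by apply: ccont_curry => t; exact: circle_coef_quotient_continuous.
have cc c : tube c -> ccont (fun t => phi (X t) (normal_section c (X t)) * (X t) ^- i).
  move=> tc; apply: (@ccont_curry (fun c t => phi (X t) (normal_section c (X t)) * (X t) ^- i)) => t.
  exact: circle_coef_integrand_continuous.
have -> : \sum_j (b 0 j - a 0 j) * cint (Q i j a b) =
    cint (fun t => \sum_(j < m.+1) (b 0 j - a 0 j) * Q i j a b t).
  rewrite cint_sum; last by move=> j; apply: ccontM; [exact: ccont_cst|exact: cQ].
  by apply: eq_bigr => j _; rewrite cintZl//; exact: cQ.
rewrite /circle_coef -cintD; last first.
- by apply: ccont_sum => j; apply: ccontM; [exact: ccont_cst|exact: cQ].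
- exact: cc.
apply: eq_cint => t _.
have -> : normal_section b (X t) = normal_section a (X t) +
    (normal_section b (X t) - normal_section a (X t)) by rewrite addrC subrK.
rewrite (segment_mean_yE hol); last first.
- rewrite addrCA subrr addr0; apply: section_disc => //; exact: X_disc.
- exact: tube_polydisc.
rewrite mulrDl; congr (_ + _).
rewrite /Q; set H := segment_mean _ _ _.
rewrite /normal_section -sumrB mulr_suml mulr_suml; apply: eq_bigr => j _.
by ring.
Qed.

Lemma circle_coef_differentiable i (F : V -> C) a : tube a -> (\forall b \near a, F b = circle_coef i b) ->
  differentiable F a /\ forall j : 'I_m.+1, 'D_(delta_mx 0 j) F a = circle_coef_partial i j a.
Proof.
move=> ta Fc.
have Qa (j : 'I_m.+1) : cint (Q i j a a) = circle_coef_partial i j a.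
  by apply: eq_cint => t _; rewrite /Q subrr segment_mean0.
have [||dF DF] := @differentiable_quotient _ _ F a (fun j b => cint (Q i j a b)).
- move=> j; apply: (@cint_continuous _ V _ (Q i j a) a open_tube_fst).
    by move=> t _ /=.
  by move=> [b t] /= tb; exact: circle_coef_quotient_continuous.
- have tn : \forall b \near a, tube b by apply: open_nbhs_nbhs; split; [exact: open_tube|].
  rewrite (nbhs_singleton Fc); near=> b.
  have -> : F b = circle_coef i b by near: b.
  by apply: circle_coef_quotient => //; near: b.
by split=> // j; rewrite DF Qa.
Unshelve. all: by end_near. Qed.

(** [F] is any function that agrees with the Cauchy integral on [U]: the Taylor coefficients [f_]
    are given functions, and are only known to be Cauchy integrals near 0. *)
Lemma circle_coef_holomorphic i (U : set V) (F : V -> C) : open U -> U `<=` tube ->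
  (forall b, U b -> F b = circle_coef i b) ->
  holomorphic U F /\ forall a, U a -> forall j : 'I_m.+1, 'D_(delta_mx 0 j) F a = circle_coef_partial i j a.
Proof.
move=> oU Ut FE.
have Un a : U a -> \forall b \near a, U b by move=> Ua; apply: open_nbhs_nbhs; split.
have FEn a : U a -> \forall b \near a, F b = circle_coef i b.
  by move=> /Un; apply: filterS => b; exact: FE.
have DE a : U a -> forall j : 'I_m.+1, 'D_(delta_mx 0 j) F a = circle_coef_partial i j a.
  by move=> Ua; have [] := circle_coef_differentiable (Ut _ Ua) (FEn _ Ua).
split; last exact: DE.
split=> // a Ua; split; first by have [] := circle_coef_differentiable (Ut _ Ua) (FEn _ Ua).
move=> j; apply: (@continuous_near_eq _ _ (circle_coef_partial i j)).
  by apply: filterS (Un _ Ua) => b Ub; rewrite DE.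
by apply: circle_coef_partial_continuous; exact: Ut.
Qed.

End SectionCoefficients.

(** * Primitives in y, and restriction of f to the graph of a section *)

Section Antiderivative.
Context {R : realType}.
Local Notation C := (cplx R).

Lemma cderiv_scale (h : C -> C) (z y d : C) : cderiv h (z * y) d ->
  cderiv (fun z => h (z * y)) z (d * y).
Proof.
move=> [q [qc <- qE]].
have yc : {for 0, continuous (fun k : C => k * y)} by apply: contM; [exact: cont_id|exact: cont_cst].
exists (fun k => q (k * y) * y); split.
- by apply: contM; [exact: (cont_comp yc (mul0r y) qc)|exact: cont_cst].
- by rewrite mul0r.
have qE' := near_preimage yc (mul0r y) qE.
near=> k; rewrite mulrDl.
have -> : h (z * y + k * y) = h (z * y) + k * y * q (k * y) by near: k.
by ring.
Unshelve. all: by end_near. Qed.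

Context (rho : R) (f fy : C -> C -> C) (hol : holomorphic_in_y rho f fy).
Local Notation D := (polydisc rho).

(** The integral of f(x, .) along the segment from 0 to y, with the point of the segment written as
    t y. *)
Definition yprimitive (x y : C) : C := y * cint (fun t => f x (rc t * y)).

Lemma scale_polydisc x y t : D (x, y) -> 0 <= t <= 1 -> D (x, rc t * y).
Proof.
move=> [/= xr yr] /andP[t0 t1]; split=> //=; apply: le_lt_trans yr.
rewrite normrM normc_rc (ger0_norm t0); apply: ler_piMl => //.
by rewrite -(rmorph1 rc) rc_le.
Qed.

Let hf z : D z -> {for z, continuous (fun z : C * C => f z.1 z.2)}.
Proof. by case: hol => _ + _; apply. Qed.

Let hfy z : D z -> {for z, continuous (fun z : C * C => fy z.1 z.2)}.
Proof. by case: hol => _ _; apply. Qed.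

Lemma cont_comp2 (T : topologicalType) (F : C -> C -> C) (u v : T -> C) z :
  {for (u z, v z), continuous (fun z : C * C => F z.1 z.2)} ->
  {for z, continuous u} -> {for z, continuous v} ->
  {for z, continuous (fun z => F (u z) (v z))}.
Proof.
move=> Fc uc vc.
exact: (cont_comp (g := fun z : C * C => F z.1 z.2) (continuous_pair uc vc) erefl Fc).
Qed.

Lemma yprimitive_continuous z : D z -> {for z, continuous (fun z : C * C => yprimitive z.1 z.2)}.
Proof.
move=> Dz; apply: contM; first exact: continuous_snd.
pose s (w : C * C * R) : C * C := (w.1.1, rc w.2 * w.1.2).
have c1 w : {for w, continuous (fun w : C * C * R => w.1.1)}.
  by apply: cont_fst; exact: continuous_fst.
have c2 w : {for w, continuous (fun w : C * C * R => rc w.2 * w.1.2)}.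
  apply: contM; first by apply: cont_rc; exact: continuous_snd.
  by apply: cont_snd; exact: continuous_fst.
have sc w : {for w, continuous s} by apply: continuous_pair; [exact: c1|exact: c2].
apply: (@cint_continuous _ _ (s @^-1` D) (fun (z : C * C) t => f z.1 (rc t * z.2))).
- by apply: open_comp; [move=> w _; exact: sc|exact: open_polydisc].
- by move=> t t01; apply: scale_polydisc t01; rewrite -surjective_pairing.
- move=> w /hf wc; apply: (@cont_comp2 _ f (fun w : C * C * R => w.1.1) (fun w => rc w.2 * w.1.2)).
  + exact: wc.
  + exact: c1.
  + exact: c2.
Qed.

(* The integrand is the derivative of t |-> t f(x, t y). *)
Lemma yprimitive_FTC x y : D (x, y) ->
  cint (fun t => f x (rc t * y) + y * rc t * fy x (rc t * y)) = f x y.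
Proof.
move=> Dxy; have [h1 _ _] := hol.
pose H (z : C) := id z * f x (z * y).
pose dH (z : C) := 1 * f x (z * y) + id z * (fy x (z * y) * y).
have idr (t : R) : 0 + rc t * 1 = rc t by rewrite add0r mulr1.
have := @segment_meanE _ H dH 0 1; rewrite /H add0r mul1r mul0r add0r mul1r mul1r => ->.
- apply: eq_cint => t _; rewrite idr /dH mul1r; congr (_ + _).
  by rewrite mulrAC [RHS]mulrCA -mulrA mulrC -mulrA mulrC.
- move=> t t01; rewrite idr; apply: cderivM; first exact: cderiv_id.
  by apply: cderiv_scale; exact: (h1 _ (scale_polydisc Dxy t01)).
- move=> t t01; rewrite idr.
  have yc : {for rc t, continuous (fun z : C => z * y)} by apply: contM; [exact: cont_id|exact: cont_cst].
  have Dt := scale_polydisc Dxy t01.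
  apply: contD; apply: contM.
  + exact: cont_cst.
  + exact: (@cont_comp2 _ f (fun=> x) (fun z : C => z * y) (rc t) (hf Dt) (@cont_cst _ _ _ _) yc).
  + exact: cont_id.
  + apply: contM; last exact: cont_cst.
    exact: (@cont_comp2 _ fy (fun=> x) (fun z : C => z * y) (rc t) (hfy Dt) (@cont_cst _ _ _ _) yc).
Qed.

Lemma yprimitive_cderiv z : D z -> cderiv (yprimitive z.1) z.2 (f z.1 z.2).
Proof.
case: z => x y Dxy /=; have [xr yr] := Dxy; rewrite /= in xr yr.
(* By Hadamard's formula for f(x, .) between t y and t (y + k), the difference (y + k) f(x, t (y +
   k)) - y f(x, t y) equals k times [K k t]. At k = 0 this is the integrand of [yprimitive_FTC]. *)
pose K (k : C) (t : R) := f x (rc t * (y + k)) + y * rc t * segment_mean (fy x) (rc t * y) (rc t * k).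
pose O1 := (fun z : C * R => (x, rc z.2 * (y + z.1))) @^-1` D.
pose O2 := (fun z : C * R => (x, rc z.2 * y)) @^-1` D.
have a0 (z : C * R) : {for z, continuous (fun z : C * R => x)} by exact: cont_cst.
have b0 (z : C * R) : {for z, continuous (fun z : C * R => rc z.2)}.
  by apply: cont_rc; exact: continuous_snd.
have a1 (z : C * R) : {for z, continuous (fun z : C * R => rc z.2 * (y + z.1))}.
  apply: contM; first exact: b0.
  by apply: contD; [exact: cont_cst|exact: continuous_fst].
have a2 (z : C * R) : {for z, continuous (fun z : C * R => rc z.2 * y)}.
  by apply: contM; [exact: b0|exact: cont_cst].
have a3 (z : C * R) : {for z, continuous (fun z : C * R => rc z.2 * z.1)}.
  by apply: contM; [exact: b0|exact: continuous_fst].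
have oO : open (O1 `&` O2).
  apply: openI.
    by apply: open_comp; [move=> z _; exact: (continuous_pair (a0 z) (a1 z))|exact: open_polydisc].
  by apply: open_comp; [move=> z _; exact: (continuous_pair (a0 z) (a2 z))|exact: open_polydisc].
have Kc z : (O1 `&` O2) z -> {for z, continuous (fun z : C * R => K z.1 z.2)}.
  move=> [z1 z2]; apply: contD.
    exact: (@cont_comp2 _ f (fun=> x) (fun z : C * R => rc z.2 * (y + z.1)) z (hf z1) (a0 z) (a1 z)).
  apply: contM; first by apply: contM; [exact: cont_cst|exact: b0].
  apply: (cont_comp (g := fun z : C * C * C => segment_mean (fy z.1.1) z.1.2 z.2)
    (continuous_pair (continuous_pair (a0 z) (a2 z)) (a3 z)) erefl).
  apply: (segment_mean_y_continuous hol); first exact: z2.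
  by case: z1 => _ /=; rewrite mulrDr.
have On k : `|y + k| < rc rho -> forall t, 0 <= t <= 1 -> (O1 `&` O2) (k, t).
  by move=> yk t t01; split; apply: scale_polydisc.
exists (fun k => cint (K k)); split.
- apply: (@cint_continuous _ _ (O1 `&` O2) K 0 oO _ Kc).
  by apply: On; rewrite addr0.
- rewrite -[RHS](yprimitive_FTC Dxy); apply: eq_cint => t _.
  by rewrite /K mulr0 segment_mean0 addr0.
have kc : {for 0, continuous (fun k : C => y + k)} by apply: contD; [exact: cont_cst|exact: cont_id].
have yn : \forall k \near (0 : C), `|y + k| < rc rho.
  by apply: (near_disc kc); rewrite addr0.
near=> k; have yk : `|y + k| < rc rho by near: k.
have y0 : `|y + 0| < rc rho by rewrite addr0.
have cc u : `|y + u| < rc rho -> ccont (fun t => f x (rc t * (y + u))).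
  move=> yu t t01; have [z1 _] := On u yu t t01.
  have rct : {for t, continuous (fun t : R => rc t * (y + u))}.
    by apply: contM; [exact: rc_continuous|exact: cont_cst].
  exact: (@cont_comp2 _ f (fun=> x) (fun t : R => rc t * (y + u)) t (hf z1) (@cont_cst _ _ _ _) rct).
have ccK : ccont (K k).
  move=> t t01; apply: (cont_comp (f := fun t : R => (k, t))
    (g := fun z : C * R => K z.1 z.2) _ erefl (Kc _ (On k yk t t01))).
  by apply: continuous_pair; [exact: cont_cst|exact: cont_id].
have cy : ccont (fun t => f x (rc t * y)).
  by have := cc 0 y0; rewrite addr0.
rewrite /yprimitive -(cintZl (y + k) (cc k yk)) -(cintZl y cy) -(cintZl k ccK).
rewrite -cintD; last first.
- by apply: ccontM; [exact: ccont_cst|exact: ccK].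
- by apply: ccontM; [exact: ccont_cst|exact: cy].
apply: eq_cint => t t01; rewrite /K.
have -> : f x (rc t * (y + k)) = f x (rc t * y) + rc t * k * segment_mean (fy x) (rc t * y) (rc t * k).
  rewrite mulrDr (segment_mean_yE hol); [by []|exact: scale_polydisc|].
  by rewrite -mulrDr; have [[]] := On k yk t t01.
by ring.
Unshelve. all: by end_near. Qed.

(** As the y-derivative of the primitive is f itself, the partial derivatives of a coefficient of
    the primitive are coefficients of f. This is how one potential yields all the equations. *)
Lemma holomorphic_in_y_primitive : holomorphic_in_y rho yprimitive f.
Proof. by split; [exact: yprimitive_cderiv|exact: yprimitive_continuous|exact: hf]. Qed.

Lemma holomorphic_in_y_opp : holomorphic_in_y rho (fun x y => - f x y) (fun x y => - fy x y).
Proof.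
have [h1 _ _] := hol; split=> z Dz.
- have := cderivM (cderiv_cst (-1) z.2) (h1 z Dz).
  rewrite mul0r add0r mulN1r (_ : (fun y => -1 * f z.1 y) = fun y => - f z.1 y)//.
  by apply/funext => y; rewrite mulN1r.
- by apply: contN; exact: hf.
- by apply: contN; exact: hfy.
Qed.

Context (fx : C -> C -> C) (s ds : C -> C)
  (fxE : forall x y, D (x, y) -> cderiv (f^~ y) x (fx x y))
  (fxc : forall z, D z -> {for z, continuous (fun z : C * C => fx z.1 z.2)})
  (sD : forall x, `|x| < rc rho -> `|s x| < rc rho)
  (sE : forall x, `|x| < rc rho -> cderiv s x (ds x))
  (dsc : forall x, `|x| < rc rho -> {for x, continuous ds}).

(** The chain rule that makes x |-> f(x, s(x)) a function to which [taylor_coef_circle] applies;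
    this is where the derivative of f in x enters. *)
Lemma cderiv_along x : `|x| < rc rho ->
  cderiv (fun x => f x (s x)) x (fx x (s x) + ds x * fy x (s x)).
Proof.
move=> xr; have Dx : D (x, s x) by split=> //=; exact: sD.
have [q1 [c1 <- E1]] := fxE Dx; have [q2 [c2 <- E2]] := sE xr.
(* The increment is split at (x + k, s x): first x moves with y fixed, then y moves by k q2(k) at
   the new x. The second quotient must therefore be continuous in x too. *)
exists (fun k => q1 k + q2 k * segment_mean (fy (x + k)) (s x) (k * q2 k)).
have xk : {for 0, continuous (fun k : C => x + k)} by apply: contD; [exact: cont_cst|exact: cont_id].
split.
- apply: contD; first exact: c1.
  apply: contM; first exact: c2.
  have cs : {for 0, continuous (fun k : C => s x)} by exact: cont_cst.
  apply: (cont_comp (g := fun z : C * C * C => segment_mean (fy z.1.1) z.1.2 z.2) (y := (x, s x, 0))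
    (continuous_pair (continuous_pair xk cs) (continuous_idM c2))).
    by rewrite addr0 mul0r.
  by apply: (segment_mean_y_continuous hol); [exact: Dx|rewrite addr0; exact: sD].
- by rewrite addr0 mul0r segment_mean0.
have xn : \forall k \near (0 : C), `|x + k| < rc rho.
  by apply: (near_disc xk); rewrite addr0.
near=> k; have xkr : `|x + k| < rc rho by near: k.
have sk : s (x + k) = s x + k * q2 k by near: k.
rewrite sk (segment_mean_yE hol); last first.
- by rewrite -sk; exact: sD.
- by split=> //=; exact: sD.
have -> : f (x + k) (s x) = f x (s x) + k * q1 k by near: k.
by ring.
Unshelve. all: by end_near. Qed.

Lemma cderiv_along_continuous x : `|x| < rc rho ->
  {for x, continuous (fun x => fx x (s x) + ds x * fy x (s x))}.
Proof.
move=> xr; have Dx : D (x, s x) by split=> //=; exact: sD.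
have sc := cderiv_continuous (sE xr).
apply: contD.
  exact: (@cont_comp2 _ fx id s x (fxc Dx) (@cont_id _ _) sc).
apply: contM; first exact: dsc.
exact: (@cont_comp2 _ fy id s x (hfy Dx) (@cont_id _ _) sc).
Qed.

End Antiderivative.

(** * Laufer curves *)

Section DirectionalDerivatives.
Context {R : realType}.
Local Notation C := (cplx R).

Lemma derive_cderiv (V : normedModType C) (F : V -> C) (p v : V) (phi : C -> C) d :
  (\forall k \near (0 : C), F (p + k *: v) = phi k) -> cderiv phi 0 d -> 'D_v F p = d.
Proof.
move=> Fphi [q [qc <- qE]].
have Fp : F p = phi 0 by have := nbhs_singleton Fphi; rewrite scale0r addr0.
apply/cvg_lim => //; have /continuous_withinNx qc' := qc.
apply: cvg_trans qc'; apply: near_eq_cvg; near=> k => /=.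
rewrite [_ + p]addrC Fp.
have -> : F (p + k *: v) = phi k by near: k; apply: nbhs_dnbhs; exact: Fphi.
have -> : phi k = phi 0 + k * q k.
  rewrite -[k in LHS]add0r; near: k; apply: nbhs_dnbhs; exact: qE.
rewrite [_ - _]addrAC subrr add0r [_ *: _]mulrA mulVf ?mul1r//.
by near: k; exact: nbhs_dnbhs_neq.
Unshelve. all: by end_near. Qed.

Lemma derive_coord a b (T : 'rV[C]_a -> 'rV[C]_b) p v j : derivable T p v ->
  'D_v T p 0 j = 'D_v (fun q => T q 0 j) p.
Proof.
move=> /cvg_ex[l Tl]; have -> : 'D_v T p = l by apply/cvg_lim.
apply/esym/cvg_lim => //.
have lc := @cont_coord R b j l.
have := @cvg_comp _ _ _ _ _ _ _ _ Tl lc.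
apply: cvg_trans; apply: near_eq_cvg; near=> k => /=.
by rewrite !mxE.
Unshelve. all: by end_near. Qed.

Lemma line_continuous (V : normedModType C) (p v : V) (x : C) :
  {for x, continuous (fun k : C => p + k *: v)}.
Proof. by apply: continuousD; [exact: cont_cst|exact: scalel_continuous]. Qed.

End DirectionalDerivatives.

(** * Coordinates on C^3 and the Jacobian of the gluing along the curve *)

Section Coordinates.
Context {R : realType}.
Local Notation C := (cplx R).
Local Notation i2 := (inord 2 : 'I_3).

Lemma inord2E : i2 = lift ord0 (lift ord0 ord0) :> 'I_3.
Proof. by apply/val_inj; rewrite /= inordK. Qed.

Lemma pt3_0 (x y z : C) : pt3 x y z 0 0 = x. Proof. by rewrite mxE. Qed.
Lemma pt3_1 (x y z : C) : pt3 x y z 0 1 = y. Proof. by rewrite mxE. Qed.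
Lemma pt3_2 (x y z : C) : pt3 x y z 0 i2 = z. Proof. by rewrite mxE inord2E. Qed.

Lemma ord3_cases (j : 'I_3) : [\/ j = 0, j = 1 | j = i2].
Proof.
case: j => [[|[|[|//]]] jn].
- by apply: Or31; apply/val_inj.
- by apply: Or32; apply/val_inj.
- by apply: Or33; apply/val_inj; rewrite /= inordK.
Qed.

Lemma pt3_eta (q : 'rV[C]_3) : q = pt3 (q 0 0) (q 0 1) (q 0 i2).
Proof.
apply/rowP => j; case: (ord3_cases j) => ->; by rewrite (pt3_0, pt3_1, pt3_2).
Qed.

Lemma pt3_add0 (x y z k : C) : pt3 x y z + k *: delta_mx 0 0 = pt3 (x + k) y z.
Proof.
apply/rowP => j; rewrite !mxE /=; case: (ord3_cases j) => -> /=; rewrite ?inord2E /=;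
  by rewrite ?mulr1 ?mulr0 ?addr0.
Qed.

Lemma pt3_add1 (x y z k : C) : pt3 x y z + k *: delta_mx 0 1 = pt3 x (y + k) z.
Proof.
apply/rowP => j; rewrite !mxE /=; case: (ord3_cases j) => -> /=; rewrite ?inord2E /=;
  by rewrite ?mulr1 ?mulr0 ?addr0.
Qed.

Lemma pt3_add2 (x y z k : C) : pt3 x y z + k *: delta_mx 0 i2 = pt3 x y (z + k).
Proof.
apply/rowP => j; rewrite !mxE /=; case: (ord3_cases j) => -> /=; rewrite ?inord2E /=;
  by rewrite ?mulr1 ?mulr0 ?addr0.
Qed.

Lemma pt3_continuous (T : topologicalType) (u v : T -> C) (x : T) :
  {for x, continuous u} -> {for x, continuous v} ->
  {for x, continuous (fun y => pt3 (u y) 0 (v y))}.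
Proof.
move=> uc vc.
rewrite (_ : (fun y => _) = fun y => (pt3 0 0 0 + u y *: delta_mx 0 0) + v y *: delta_mx 0 i2).
  apply: continuousD.
    exact: (cont_comp (g := fun k : C => pt3 0 0 0 + k *: delta_mx 0 0) uc erefl
      (@line_continuous _ _ _ _ _)).
  have := cont_comp (g := fun k : C => 0 + k *: delta_mx 0 i2 : 'rV[C]_3) vc erefl
    (@line_continuous _ _ _ _ _).
  rewrite (_ : (fun z => 0 + v z *: _) = fun z => v z *: delta_mx 0 i2)//.
  by apply/funext => z; rewrite add0r.
by apply/funext => y; rewrite pt3_add0 pt3_add2 !add0r.
Qed.

Lemma holomorphic_line (A : set 'rV[C]_3) (F : 'rV[C]_3 -> C) (p : 'rV[C]_3) i :
  holomorphic A F -> A p ->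
  cderiv (fun k => F (p + k *: delta_mx 0 i)) 0 ('D_(delta_mx 0 i) F p).
Proof.
move=> [_ AF] /AF[dF _].
have dv : derivable F p (delta_mx 0 i) by exact: diff_derivable.
have [q [qc q0 qE]] := derivable_quotient dv.
exists q; split; [exact: qc|exact: q0|near=> k].
by rewrite add0r scale0r addr0.
Unshelve. all: by end_near. Qed.

Lemma cderiv_shift (h : C -> C) (x d : C) : cderiv (fun k => h (x + k)) 0 d -> cderiv h x d.
Proof.
move=> [q [qc q0 qE]]; exists q; split; [exact: qc|exact: q0|].
by apply: filterS qE => k; rewrite add0r addr0.
Qed.

Lemma holomorphic_continuous d (A : set 'rV[C]_d) (F : 'rV[C]_d -> C) p :
  holomorphic A F -> A p -> {for p, continuous F}.
Proof. by move=> [_ AF] /AF[dF _]; exact: differentiable_continuous. Qed.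

(** Rows of the Jacobian are directions in the source. The behaviour on the three coordinate lines
    makes the entries above the diagonal vanish; the unspecified [F] contributes only below the
    diagonal, so the determinant is the product of the derivatives of 1/x, x^n y1 and x^-m y2. *)
Lemma normal_form_det (T : 'rV[C]_3 -> 'rV[C]_3) (F : C -> C) (t : C) (m n : nat) :
  t != 0 -> differentiable T (pt3 t 0 0) ->
  (\forall k \near (0 : C), T (pt3 (t + k) 0 0) = pt3 (t + k)^-1 0 0) ->
  (\forall k \near (0 : C), T (pt3 t k 0) = pt3 t^-1 (t ^+ n * k) 0) ->
  (\forall k \near (0 : C), T (pt3 t 0 k) = pt3 t^-1 (F k) (t ^- m * k)) ->
  \det (jacobian T (pt3 t 0 0)) = - (t ^+ 2)^-1 * t ^+ n * t ^- m.
Proof.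
move=> t0 dT T0 T1 T2; set p := pt3 t 0 0.
have JE i j (phi : C -> C) d : (\forall k \near (0 : C), T (p + k *: delta_mx 0 i) 0 j = phi k) ->
    cderiv phi 0 d -> jacobian T p i j = d.
  move=> Tphi phid; rewrite -(derive_cderiv (F := fun q => T q 0 j) Tphi phid).
  have dv : derivable T p (delta_mx 0 i) by exact: diff_derivable.
  by rewrite -derive_coord// deriveEjacobian// -rowE [RHS]mxE.
have lin (c : C) : cderiv (fun k => c * k) 0 c.
  have := cderivM (cderiv_cst c 0) (cderiv_id 0).
  by rewrite mul0r add0r mulr1.
have dcst (c : C) : cderiv (fun=> c) 0 0 by exact: cderiv_cst.
have J00 : jacobian T p 0 0 = - (t ^+ 2)^-1.
  apply: (JE _ _ (fun k => (t + k)^-1)).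
    by apply: filterS T0 => k Tk; rewrite /p pt3_add0 Tk pt3_0.
  have := cderivV (h := fun k => t + k) (x := 0) (d := 0 + 1).
  rewrite addr0 add0r mulN1r; apply; first exact: t0.
  by have := cderivD (cderiv_cst t 0) (cderiv_id 0); rewrite add0r.
have J01 : jacobian T p 0 1 = 0.
  apply: (JE _ _ (fun=> 0)); last exact: dcst.
  by apply: filterS T0 => k Tk; rewrite /p pt3_add0 Tk pt3_1.
have J02 : jacobian T p 0 i2 = 0.
  apply: (JE _ _ (fun=> 0)); last exact: dcst.
  by apply: filterS T0 => k Tk; rewrite /p pt3_add0 Tk pt3_2.
have J11 : jacobian T p 1 1 = t ^+ n.
  apply: (JE _ _ (fun k => t ^+ n * k)); last exact: lin.
  by apply: filterS T1 => k Tk; rewrite /p pt3_add1 add0r Tk pt3_1.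
have J12 : jacobian T p 1 i2 = 0.
  apply: (JE _ _ (fun=> 0)); last exact: dcst.
  by apply: filterS T1 => k Tk; rewrite /p pt3_add1 add0r Tk pt3_2.
have J22 : jacobian T p i2 i2 = t ^- m.
  apply: (JE _ _ (fun k => t ^- m * k)); last exact: lin.
  by apply: filterS T2 => k Tk; rewrite /p pt3_add2 add0r Tk pt3_2.
rewrite det_trig.
  rewrite !big_ord_recl big_ord0 mulr1 mulrA -inord2E.
  have -> : lift ord0 ord0 = 1 :> 'I_3 by apply/val_inj.
  by rewrite J00 J11 J22.
apply/is_trig_mxP => i j ij.
case: (ord3_cases i) (ord3_cases j) ij => -> [] -> //=; rewrite ?inordK//.
Qed.

End Coordinates.

(** * The degree relation, and a polydisc on which f is holomorphic *)

Section LauferCurve.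
Context {R : realType}.
Local Notation C := (cplx R).
Local Notation i2 := (inord 2 : 'I_3).
Context (X : complex_manifold R 3) (Z : set X) (m n : nat) (c0 c1 : chart R 3 X)
  (f : C -> C -> C) (laufer : laufer_curve Z m n c0 c1 f).

Let S (q : 'rV[C]_3) : C := f (q 0 0) (q 0 i2).

Lemma laufer_holomorphic : holomorphic (image_of c0) S.
Proof. by case: (laufer_f laufer). Qed.

Lemma image_axis0 x : image_of c0 (pt3 x 0 0).
Proof. by apply: (laufer_affine0 laufer); exists x. Qed.

Lemma image_axis1 x : image_of c1 (pt3 x 0 0).
Proof. by apply: (laufer_affine1 laufer); exists x. Qed.

Lemma laufer_axis x : f x 0 = 0.
Proof.
have [_ /(_ _ (image_axis0 x))[B [[_ Bx] [_ [N [u [v [uv E]]]]]]]] := laufer_f laufer.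
have := E _ Bx; rewrite pt3_0 pt3_2 => ->; rewrite big1// => i _.
have [[_ ui] _] := uv i; rewrite ui ?mul0r//.
by exists x.
Qed.

Lemma laufer_transition q : overlap c0 c1 q -> q 0 0 != 0 /\
  transition c0 c1 q = pt3 (q 0 0)^-1 (q 0 0 ^+ n * q 0 1 + f (q 0 0) (q 0 i2)) (q 0 0 ^- m * q 0 i2).
Proof.
move=> [p [p0 p1] <-]; rewrite /transition coordK//.
exact: (laufer_gluing laufer p0 p1 (pt3_eta _)).
Qed.

(** The whole x-axis lies in the domain, so restriction to the curve gives an entire function. This
    is applied to the coefficients of the 3-form in both charts. *)
Lemma axis_cderiv (A : set 'rV[C]_3) (F : 'rV[C]_3 -> C) : holomorphic A F ->
  (forall x, A (pt3 x 0 0)) ->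
  (forall x, cderiv (fun x => F (pt3 x 0 0)) x ('D_(delta_mx 0 0) F (pt3 x 0 0))) /\
  (forall x, {for x, continuous (fun x => 'D_(delta_mx 0 0) F (pt3 x 0 0))}).
Proof.
move=> hF Aax; split=> x.
  apply: cderiv_shift; have := holomorphic_line 0 hF (Aax x).
  rewrite (_ : (fun k => F (pt3 x 0 0 + _)) = fun k => F (pt3 (x + k) 0 0))//.
  by apply/funext => k; rewrite pt3_add0.
have [_ AF] := hF; have [_ /(_ 0) Dc] := AF _ (Aax x).
have pc : {for x, continuous (fun x : C => pt3 x 0 0)}.
  by apply: pt3_continuous; [exact: cont_id|exact: cont_cst].
exact: (cont_comp pc erefl Dc).
Qed.

Lemma laufer_det t : t != 0 ->
  transition c0 c1 (pt3 t 0 0) = pt3 t^-1 0 0 /\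
  \det (jacobian (transition c0 c1) (pt3 t 0 0)) = - (t ^+ 2)^-1 * t ^+ n * t ^- m.
Proof.
move=> t0; have pO := laufer_overlap0 laufer t0.
have [oO hT] := atlas_compatible (laufer_atlas0 laufer) (laufer_atlas1 laufer).
have [_ Tp] := laufer_transition pO.
rewrite pt3_0 pt3_1 pt3_2 laufer_axis !mulr0 addr0 in Tp; split=> //.
have [dT _] := hT _ pO.
(* The overlap is open, so the gluing formula holds on short pieces of the coordinate lines through
   the point. *)
have near_line i : \forall k \near (0 : C), overlap c0 c1 (pt3 t 0 0 + k *: delta_mx 0 i).
  have lc := @line_continuous R 'rV[C]_3 (pt3 t 0 0) (delta_mx 0 i) 0.
  have l0 : pt3 t 0 0 + 0 *: delta_mx 0 i = pt3 t 0 0 by rewrite scale0r addr0.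
  apply: (near_preimage lc l0); exact: open_nbhs_nbhs.
apply: (@normal_form_det R _ (f t)) => //.
- apply: filterS (near_line 0) => k; rewrite pt3_add0 => /laufer_transition[_ ->].
  by rewrite pt3_0 pt3_1 pt3_2 laufer_axis !mulr0 addr0.
- apply: filterS (near_line 1) => k; rewrite pt3_add1 add0r => /laufer_transition[_ ->].
  by rewrite pt3_0 pt3_1 pt3_2 laufer_axis !mulr0 addr0.
- apply: filterS (near_line i2) => k; rewrite pt3_add2 add0r => /laufer_transition[_ ->].
  by rewrite pt3_0 pt3_1 pt3_2 !mulr0 add0r.
Qed.

Lemma trivial_canonical_bundle_degree : trivial_canonical_bundle X -> n = m.+2.
Proof.
move=> [omega [omh omE]].
have [h0 nz0] := omh _ (laufer_atlas0 laufer).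
have [h1 nz1] := omh _ (laufer_atlas1 laufer).
have [d0 dc0] := axis_cderiv h0 image_axis0.
have [d1 dc1] := axis_cderiv h1 image_axis1.
pose g0 x := omega c0 (pt3 x 0 0); pose g1 x := omega c1 (pt3 x 0 0).
have g0n x : g0 x != 0 by apply: nz0; exact: image_axis0.
have g1n x : g1 x != 0 by apply: nz1; exact: image_axis1.
have g1c : {for 0, continuous g1} := cderiv_continuous (d1 0).
have gE t : t != 0 -> g0 t = g1 t^-1 * (- (t ^+ 2)^-1 * t ^+ n * t ^- m).
  move=> t0; have [Tt dt] := laufer_det t0.
  have := omE _ _ (laufer_atlas0 laufer) (laufer_atlas1 laufer) _ (laufer_overlap0 laufer t0).
  by rewrite Tt dt.
have [nm|mn|//] := ltngtP n m.+2.
- have E t : t != 0 -> g0 t = - g1 t^-1 * t ^- (m.+2 - n).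
    move=> t0; rewrite gE//.
    have {1}-> : t ^- m = t ^+ 2 * t ^- m.+2.
      by rewrite -[m.+2]addn2 exprD; field; rewrite t0 expf_neq0.
    have -> : t ^- m.+2 = t ^- (m.+2 - n) * t ^- n.
      by rewrite -invfM -exprD subnK// ltnW.
    by field; rewrite !expf_neq0.
  have := entire_eq0 d0 dc0 (contN g1c) _ E.
  by rewrite subn_gt0 => /(_ nm) /eqP; rewrite (negPf (g0n 0)).
- have E t : t != 0 -> (g0 t)^-1 = - (g1 t^-1)^-1 * t ^- (n - m.+2).
    move=> t0; rewrite gE//.
    have -> : t ^+ n = t ^+ (n - m.+2) * (t ^+ 2 * t ^+ m).
      by rewrite -!exprD add2n subnK// ltnW.
    by field; rewrite !expf_neq0 ?g1n.
  have dV x := cderivV (g0n x) (d0 x).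
  have g0c x : {for x, continuous g0} := cderiv_continuous (d0 x).
  have dVc x : {for x, continuous (fun x => - 'D_(delta_mx 0 0) (omega c0) (pt3 x 0 0) / g0 x ^+ 2)}.
    apply: contM; first by apply: contN; exact: dc0.
    by apply: contV; [rewrite expf_neq0|apply: contX; exact: g0c].
  have := entire_eq0 dV dVc (contN (contV (g1n 0) g1c)) _ E.
  by rewrite subn_gt0 => /(_ mn) /eqP; rewrite invr_eq0 (negPf (g0n 0)).
Qed.

(** f is read off on the slice y1 = 0 of the chart, which contains (x, 0, y2) for small x and y2.
    The bound rho <= 1 is imposed for the sake of [section_disc]. *)
Lemma laufer_polydisc : exists rho : R, exists fx fy : C -> C -> C,
  [/\ 0 < rho <= 1, holomorphic_in_y rho f fy,
      forall x y, polydisc rho (x, y) -> cderiv (f^~ y) x (fx x y) &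
      forall z, polydisc rho z -> {for z, continuous (fun z : C * C => fx z.1 z.2)}].
Proof.
have [oI hI] := laufer_holomorphic.
have pc (z : C * C) : {for z, continuous (fun z : C * C => pt3 z.1 0 z.2)}.
  by apply: pt3_continuous; [exact: continuous_fst|exact: continuous_snd].
have : \forall z \near ((0, 0) : C * C), image_of c0 (pt3 z.1 0 z.2).
  apply: (near_preimage (pc (0, 0)) erefl); apply: open_nbhs_nbhs; split; first exact: oI.
  exact: image_axis0.
move=> [[A B] /= [/near_ballP[r1 r10 Ar] /near_ballP[r2 r20 Br]] AB].
pose rho := Num.min 1 (Num.min r1 r2).
have Dim z : polydisc rho z -> image_of c0 (pt3 z.1 0 z.2).
  move=> [z1 z2]; apply: AB; split=> /=.
    apply: Ar; rewrite sub0r normrN; apply: lt_le_trans z1 _.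
    by rewrite rc_le /rho !ge_min lexx ?orbT.
  apply: Br; rewrite sub0r normrN; apply: lt_le_trans z2 _.
  by rewrite rc_le /rho !ge_min lexx ?orbT.
exists rho, (fun x y => 'D_(delta_mx 0 0) S (pt3 x 0 y)), (fun x y => 'D_(delta_mx 0 i2) S (pt3 x 0 y)).
have Dc i z : polydisc rho z -> {for z, continuous (fun z : C * C => 'D_(delta_mx 0 i) S (pt3 z.1 0 z.2))}.
  by move=> /Dim/hI[_ /(_ i) h]; exact: (cont_comp (pc z) erefl h).
split; [|split| |].
- by rewrite !lt_min ltr01 r10 r20 ge_min lexx.
- move=> [x y] /Dim /= Ip; apply: cderiv_shift.
  have := holomorphic_line i2 laufer_holomorphic Ip.
  rewrite (_ : (fun k => S (pt3 x 0 y + _)) = fun k => f x (y + k))//.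
  by apply/funext => k; rewrite pt3_add2 /S pt3_0 pt3_2.
- move=> z Dz; have Sc := holomorphic_continuous laufer_holomorphic (Dim z Dz).
  have := cont_comp (pc z) erefl Sc.
  rewrite (_ : (fun w : C * C => S (pt3 w.1 0 w.2)) = fun w => f w.1 w.2)//.
  by apply/funext => w; rewrite /S pt3_0 pt3_2.
- exact: Dc.
- move=> x y /Dim /= Ip; apply: cderiv_shift.
  have := holomorphic_line 0 laufer_holomorphic Ip.
  rewrite (_ : (fun k => S (pt3 x 0 y + _)) = fun k => f (x + k) y)//.
  by apply/funext => k; rewrite pt3_add0 /S pt3_0 pt3_2.
- exact: Dc.
Qed.

End LauferCurve.

(** * The potential and the equality of ideal sheaves *)

Section Potential.
Context {R : realType}.
Local Notation C := (cplx R).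

(** Coefficients are reindexed by [sigma]. As [sigma] is its own inverse, the hypothesis is
    symmetric in [g] and [h], and a single inclusion has to be proved. *)
Lemma ideal_sheaf_perm d (U : set 'rV[C]_d) (I : finType) (sigma : I -> I)
    (g h : I -> 'rV[C]_d -> C) : involutive sigma ->
  (forall i q, U q -> g i q = h (sigma i) q) -> ideal_sheaf U g = ideal_sheaf U h.
Proof.
move=> sK gh.
have sub (g1 h1 : I -> 'rV[C]_d -> C) : (forall i q, U q -> g1 i q = h1 (sigma i) q) ->
    forall V s, ideal_sheaf U g1 V s -> ideal_sheaf U h1 V s.
  move=> gh1 V s [VU [hs loc]]; split=> //; split=> // p Vp.
  have [B [oB [BV [u [hu su]]]]] := loc p Vp.
  exists B; split=> //; split=> //; exists (fun i => u (sigma i)); split=> [i|q Bq].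
    exact: hu.
  rewrite su// (reindex_inj (inv_inj sK)) /=; apply: eq_bigr => i _.
  by rewrite gh1 ?sK//; apply/VU/BV.
apply/funext => V; apply/funext => s; apply/propext; split; apply: sub => //.
by move=> i q Uq; rewrite gh ?sK.
Qed.

Lemma section_cderiv m (a : 'rV[C]_m.+1) x :
  cderiv (normal_section a) x (\sum_(i < m.+1) (0 * x ^+ i + a 0 i * (i%:R * x ^+ i.-1))).
Proof.
apply: (@cderiv_sum R m.+1 (fun i x => a 0 i * x ^+ i)
  (fun i x => 0 * x ^+ i + a 0 i * (i%:R * x ^+ i.-1))) => i.
by apply: cderivM; [exact: cderiv_cst|exact: cderivX].
Qed.

Lemma section_deriv_continuous m (a : 'rV[C]_m.+1) x :
  {for x, continuous (fun x : C => \sum_(i < m.+1) (0 * x ^+ i + a 0 i * (i%:R * x ^+ i.-1)))}.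
Proof.
have cX k : {for x, continuous (fun y : C => y ^+ k)} by apply: contX; exact: cont_id.
apply: cont_sum => i; apply: contD; first by apply: contM; [exact: cont_cst|exact: cX].
by apply: contM; [exact: cont_cst|apply: contM; [exact: cont_cst|exact: cX]].
Qed.

End Potential.

Theorem proposition2 (R : realType) (X : complex_manifold R 3) (C : set X)
    (m n : nat) (c0 c1 : chart R 3 X) (f : cplx R -> cplx R -> cplx R)
    (f_ : nat -> 'rV[cplx R]_m.+1 -> cplx R) :
  (2 <= n)%N ->
  trivial_canonical_bundle X ->
  laufer_curve C m n c0 c1 f ->
  taylor_expansion f f_ ->
  exists U' : set 'rV[cplx R]_m.+1, open_nbhs (0 : 'rV[cplx R]_m.+1) U' /\
    forall U : set 'rV[cplx R]_m.+1,
      open_nbhs (0 : 'rV[cplx R]_m.+1) U ->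
      U `<=` U' ->
      (forall i : 'I_n.-1, holomorphic U (versal_equations f_ i)) /\
      exists W : 'rV[cplx R]_m.+1 -> cplx R,
        holomorphic U W /\
        ideal_sheaf U (versal_equations (n := n) f_) =
        ideal_sheaf U (partials W).
Proof.
move=> _ tcb laufer tay.
(* Once n is m.+2, the index type 'I_n.-1 of the equations is by computation the index type 'I_m.+1
   of the partial derivatives. *)
have nm := trivial_canonical_bundle_degree laufer tcb; move: laufer; rewrite {}nm => laufer.
have [rho [fx [fy [/andP[rho0 rho1] hol fxE fxc]]]] := laufer_polydisc laufer.
pose r := rho / 2; have r_rho : 0 < r < rho by rewrite /r; apply/andP; split; lra.
have X_neq0 t : rc r * circ t != 0 by exact: (X_neq0 r_rho).
have holN := holomorphic_in_y_opp hol; have holW := holomorphic_in_y_primitive holN.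
(* The interior makes the expansion available at every point of an open set. The neighbourhood of x
   = 0 on which it holds may still depend on a; the circle of radius [r] does not. *)
exists (tube rho `&` [set a | \forall x \near (0 : cplx R),
   series (fun i => f_ i a * x ^+ i) @ \oo --> f x (normal_section a x)]^°).
split.
  split; first by apply: openI; [exact: open_tube|exact: open_interior].
  split; first exact: tube0 r_rho.
  exact: tay.
move=> U [oU U0] UU'.
have Ut : U `<=` tube rho by move=> a /UU'[].
have versalE (i : nat) a : U a -> - f_ i a = circle_coef r (fun x y => - f x y) i a.
  move=> Ua; have ta := Ut a Ua; have [_ /interior_subset tay_a] := UU' a Ua.
  have sD x : `|x| < rc rho -> `|normal_section a x| < rc rho by exact: section_disc.
  have sE x (_ : `|x| < rc rho) := section_cderiv a x.
  have sc x (_ : `|x| < rc rho) := @section_deriv_continuous R m a x.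
  have gd := cderiv_along hol fxE sD sE.
  have gc := cderiv_along_continuous hol fxc sD sE sc.
  rewrite (@taylor_coef_circle R (fun i => f_ i a) _ _ rho r i gd gc tay_a r_rho).
  rewrite -mulN1r -cintZl.
    by apply: eq_cint => t _; rewrite mulN1r mulNr.
  apply: ccontM.
    apply: (@ccont_circ R (fun x => f x (normal_section a x))) => t.
    by apply: cderiv_continuous (gd _ _); exact: X_disc.
  move=> t _; apply: (cont_X_inv_pow (f := fun t => t) r_rho); exact: cont_id.
split.
  move=> i; have [] := circle_coef_holomorphic rho1 r_rho holN (i := i.+1)
    (F := versal_equations (n := m.+2) f_ i) oU Ut.
    by move=> a Ua; rewrite /versal_equations versalE.
  by [].
(* This witness does not depend on [U]: the same function serves every neighbourhood inside the one
   chosen above. *)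
exists (circle_coef r (yprimitive (fun x y => - f x y)) m.+1).
have [hW DW] := circle_coef_holomorphic rho1 r_rho holW (i := m.+1) oU Ut (fun a _ => erefl).
split; first exact: hW.
(* [rev_ord] sends i to m - i, and X^(m-i) X^-(m+1) = X^-(i+1): the partial derivative in a_(m-i) is
   the equation of index i, that is k_(i+1). *)
apply: (@ideal_sheaf_perm R _ U 'I_m.+1 (@rev_ord m.+1)); first exact: rev_ordK.
move=> i a Ua; rewrite /versal_equations /partials versalE// DW//.
apply: eq_cint => t _; rewrite mulrC; congr (_ * _).
rewrite /= subSS; have im : (i <= m)%N by rewrite -ltnS.
have -> : (rc r * circ t) ^- m.+1 = (rc r * circ t) ^- (m - i) * (rc r * circ t) ^- i.+1.
  by rewrite -invfM -exprD addnS subnK.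
by rewrite mulrA mulfV ?mul1r// expf_neq0.
Qed.
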